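(* Let $A\in\mathbb{C}^{N\times N}$ be a diagonalizable matrix with spectral radius $\rho(A)$ and eigenvector basis $Z$ (so $A=Z\Lambda Z^{-1}$ with $\Lambda$ diagonal), and let $\kappa(Z)=\|Z\|\,\|Z^{-1}\|$. Let $M\ge 2$ be an integer, and assume that $c\in\mathbb{C}$, $c\neq 0$, $c\ne 1$, is such that $(I-A\otimes T_M)^{-1}$ can be expanded into a convergent Taylor series centered at $c$. Suppose that $$M\ \ge\ 9\rho(A)\,\frac{1}{|c|}\left(\ln\left(\frac{|1-c|}{|c|}\right)\right)^{-2}+1,$$ and set $$\mu_M:=\exp\left(\sqrt{\frac{9\rho(A)}{(M-1)|c|}}\right),\qquad K_M:=\big|(|1-c|-|c|\mu_M)M\big|^{-1}+28\,\big\|(I-A\otimes\hat T_M)^{-1}\big\|$$ (with the convention $0^{-1}=+\infty$ in the definition of $K_M$). Then for every $t\in[-1,1]$ $$\left\|\exp(A(t+1))-(I\otimes\phi(t)^T)(I-A\otimes T_M)^{-1}(I\otimes e_1\sqrt2)\right\|\le \kappa(Z)\,K_M\,M\left|\frac{c\,\mu_M}{1-c}\right|^{M-1}.$$ Moreover, if $\rho(A)>0$ and $c=-9\rho(A)/(M-1)$ is an admissible value (i.e. $(I-A\otimes T_M)^{-1}$ can be expanded into a convergent Taylor series centered at this $c$), then for $M\ge 18\rho(A)+1$ and every $t\in[-1,1]$ the bound becomes $$\left\|\exp(A(t+1))-(I\otimes\phi(t)^T)(I-A\otimes T_M)^{-1}(I\otimes e_1\sqrt2)\right\|\le \kappa(Z)\,K_M\,M\left|\frac{9\rho(A)\,e}{M-1}\right|^{M-1},$$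 where $e=\exp(1)$ and, for this value $c=-9\rho(A)/(M-1)$ (for which $\mu_M=e$), $$K_M=\left|\left(1+\frac{9\rho(A)}{M-1}-\frac{9\rho(A)\,e}{M-1}\right)M\right|^{-1}+28\,\big\|(I-A\otimes\hat T_M)^{-1}\big\|.$$
   Context: $\|\cdot\|$ denotes the spectral norm (the operator norm induced by the Euclidean, respectively $\ell^2$, norm); $\otimes$ is the Kronecker product; $I$ is an identity matrix of the appropriate size. Legendre basis: $\{p_k\}_{k\ge0}$ are the Legendre polynomials normalized to be orthonormal on $[-1,1]$, $\int_{-1}^1p_kp_\ell\,d\tau=\delta_{k\ell}$, with positive leading coefficients (so $p_0=1/\sqrt2$). $\phi(t)=(p_0(t),p_1(t),p_2(t),\dots)^T$, a finite (length $M$) or infinite vector according to the size of the matrix it multiplies; here it has length $M$. $e_1$ is the first unit vector (here of length $M$). Coefficient matrices: $\Theta(x)=1$ for $x\ge0$ and $\Theta(x)=0$ for $x<0$. The infinite matrix $T_\infty=[t_{k,\ell}]_{k,\ell\ge0}$ has entries $$t_{k,\ell}=\int_{-1}^1\int_{-1}^1\Theta(\tau-\rho)\,p_k(\tau)\,p_\ell(\rho)\,d\rho\,d\tau .$$ $T_M\in\mathbb{R}^{M\times M}$ (rows and columns indexed $0,\dots,M-1$) has entries $t_{k,\ell}$ for $0\le k\le M-2$, $0\le\ell\le M-1$, and its last row (index $M-1$) is zero. $\hat T_M$ is the infinite matrix whose leading $M\times M$ block is $T_M$ and all of whose other entries are zero; $A\otimes\hat T_M$ acts on $\mathbb{C}^N\otimes\ell^2$.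 ''$(I-X)^{-1}$ can be expanded into a convergent Taylor series centered at $c$'' means that the series $\sum_{k=0}^\infty\frac{(X-cI)^k}{(1-c)^{k+1}}$ converges (to $(I-X)^{-1}$). *)

(* Defs.v *)
From HB Require Import structures.
From mathcomp Require Import all_boot all_order all_algebra.
From mathcomp Require Import complex mxtens ring zify.
From mathcomp Require Import all_classical all_reals all_analysis.

Set Implicit Arguments.
Unset Strict Implicit.
Unset Printing Implicit Defensive.

Import Order.TTheory GRing.Theory Num.Theory.
Import numFieldNormedType.Exports.

Local Open Scope classical_set_scope.
Local Open Scope ring_scope.
Local Open Scope complex_scope.

(* MathComp-Analysis puts no topology on [R[i]]; give it the one of its norm. *)
HB.instance Definition _ (R : realType) := NormedModule.copy R[i] (R[i])^o.

Section Norms.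
Variable R : realType.

Definition enorm n (v : 'cV[R[i]]_n) : R :=
  Num.sqrt (\sum_(i < n) Normc.normc (v i 0) ^+ 2).

Definition specnorm m n (A : 'M[R[i]]_(m, n)) : R :=
  sup [set enorm (A *m v) | v in [set v : 'cV[R[i]]_n | enorm v <= 1]].

Definition specradius n (A : 'M[R[i]]_n) : R :=
  sup [set Normc.normc a | a in [set a : R[i] | eigenvalue A a]].

Definition cond n (Z : 'M[R[i]]_n) : R := specnorm Z * specnorm (invmx Z).

Definition expmx n (A : 'M[R[i]]_n) : 'M[R[i]]_n :=
  limn (series (fun k => (k`!%:R)^-1 *: A ^+ k)).

Definition taylor_expandable n (X : 'M[R[i]]_n) (c : R[i]) : Prop :=
  1%:M - X \in unitmx /\
  series (fun k => ((1 - c) ^- k.+1) *: (X - c%:M) ^+ k) @ \oo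
    --> invmx (1%:M - X).

End Norms.

Section Legendre.
Variable R : realType.
Implicit Types p q : {poly R}.

(* Rodrigues' formula; the squared L^2 norm of the classical polynomial on     *)
(* [-1, 1] is 2 / (2k + 1). The lemmas [size_legendre],                         *)
(* [lead_coef_legendre_gt0] and [legendre_orthonormal] show that this is the    *)
(* orthonormal family with positive leading coefficients.                        *)
Definition legendre (k : nat) : {poly R} :=
  Num.sqrt ((2 * k + 1)%:R / 2) *:
    (((2 ^ k * k`!)%:R)^-1 *: (('X ^+ 2 - 1) ^+ k)^`(k)).

Definition pint p : R := \int[lebesgue_measure]_(x in `[-1, 1]) p.[x].

Lemma pint_deriv p : pint (deriv p) = p.[1] - p.[-1].
Proof.
rewrite /pint /Rintegral (@continuous_FTC2 R (horner (deriv p)) (horner p)) //.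
- exact/continuous_subspaceT/continuous_horner.
- split; first by move=> x _; exact: derivable_horner.
  + exact/cvg_at_right_filter/continuous_horner.
  + exact/cvg_at_left_filter/continuous_horner.
- by move=> x _; rewrite derivE.
Qed.

Lemma antideriv p : exists q, deriv q = p.
Proof.
exists (\poly_(i < (size p).+1) (p`_i.-1 / i%:R)).
apply/polyP => i; rewrite coef_deriv coef_poly ltnS.
case: ltnP => [_|sp]; last by rewrite nth_default // mul0rn.
by rewrite /= -[LHS]mulr_natr divfK ?pnatr_eq0.
Qed.

Lemma pintD p q : pint (p + q) = pint p + pint q.
Proof.
have [[P <-] [Q <-]] := (antideriv p, antideriv q).
by rewrite -derivD !pint_deriv !hornerD; ring.
Qed.

Lemma pintZ c p : pint (c *: p) = c * pint p.
Proof.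
by have [P <-] := antideriv p; rewrite -derivZ !pint_deriv !hornerZ; ring.
Qed.

Lemma pint_parts p q : p.[1] = 0 -> p.[-1] = 0 ->
  pint (deriv p * q) = - pint (p * deriv q).
Proof.
move=> p1 pN1; apply/eqP; rewrite -subr_eq0 opprK -pintD -derivM pint_deriv.
by rewrite !hornerM p1 pN1 !mul0r subrr.
Qed.

Local Definition u : {poly R} := 'X ^+ 2 - 1.

Lemma u1 : u.[1] = 0. Proof. by rewrite !hornerE; ring. Qed.
Lemma uN1 : u.[-1] = 0. Proof. by rewrite !hornerE; ring. Qed.

Lemma derivn_u n j : (j <= n)%N -> exists q, (u ^+ n)^`(j) = u ^+ (n - j) * q.
Proof.
elim: j => [|j IH] jn; first by exists 1; rewrite mulr1 subn0.
have [q qE] := IH (ltnW jn).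
exists ((deriv u * q) *+ (n - j) + u * deriv q).
rewrite derivnS qE derivM deriv_exp.
rewrite -(subnSK jn) exprS /=.
by rewrite mulrnAl mulrDr mulrnAr; congr (_ *+ _ + _); ring.
Qed.

Lemma pint_u n q j : (j <= n)%N ->
  pint ((u ^+ n)^`(n) * q) = (-1) ^+ j * pint ((u ^+ n)^`(n - j) * q^`(j)).
Proof.
elim: j => [|j IH] jn; first by rewrite subn0 mul1r.
rewrite IH 1?ltnW // -(subnSK jn) derivnS pint_parts.
- by rewrite -derivnS exprS; ring.
- have [r ->] := derivn_u (leq_subr j.+1 n).
  by rewrite subKn // exprS !hornerM u1 !mul0r.
- have [r ->] := derivn_u (leq_subr j.+1 n).
  by rewrite subKn // exprS !hornerM uN1 !mul0r.
Qed.

Lemma u_monic : u \is monic.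
Proof. by rewrite /u -[1]/(1%:P) monicXnsubC. Qed.

Lemma size_u n : size (u ^+ n) = (2 * n).+1.
Proof.
rewrite -[LHS]prednK ?size_poly_gt0 ?expf_neq0 ?monic_neq0 ?u_monic //.
by rewrite size_exp /u -[1]/(1%:P) size_XnsubC.
Qed.

Lemma pint_un n :
  (-1) ^+ n * pint (u ^+ n) * (2 * n).+1`!%:R = 2 * (2 ^ n * n`!)%:R ^+ 2.
Proof.
elim: n => [|n IH].
  by rewrite !expr0 -derivX pint_deriv !hornerE /=; ring.
have rec : pint (u ^+ n.+1) * (2 * n.+1 + 1)%:R = - (2 * n.+1)%:R * pint (u ^+ n).
  have := @pint_parts (u ^+ n.+1) 'X.
  rewrite !horner_exp u1 uN1 !expr0n /= => /(_ erefl erefl).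
  rewrite derivX mulr1.
  have -> : deriv (u ^+ n.+1) * 'X = (2 * n.+1)%:R *: (u ^+ n.+1 + u ^+ n).
    have uX : 'X * 'X = u + 1 by rewrite /u subrK expr2.
    rewrite deriv_exp /= {1}/u derivB derivXn -[1]/(1%:P) derivC subr0 expr1.
    rewrite exprS scaler_nat mulrnA !mulrnAl; congr (_ *+ _).
    transitivity ('X * 'X * u ^+ n *+ 2); first by ring.
    by rewrite uX; ring.
  rewrite pintZ pintD => H; rewrite natrD mulrDr mulr1.
  by rewrite -[X in _ + X]opprK -H; ring.
have -> : (2 * n.+1).+1 = (2 * n).+3 by lia.
rewrite !factS !natrM expnS natrM exprS.
have <- : (2 * n.+1 + 1)%:R = (2 * n).+3%:R :> R by congr (_%:R); lia.
have -> : (2 * n).+2%:R = 2 * n.+1%:R :> R by rewrite -natrM; congr (_%:R); lia.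
rewrite factS !natrM in IH.
transitivity ((-1) ^+ n * (- (pint (u ^+ n.+1) * (2 * n.+1 + 1)%:R)) *
  (2 * n.+1%:R * ((2 * n).+1%:R * ((2 * n)`!)%:R))); first by ring.
rewrite rec natrM.
transitivity ((2 * n.+1%:R) ^+ 2 * ((-1) ^+ n * pint (u ^+ n) *
  ((2 * n).+1%:R * ((2 * n)`!)%:R))); first by ring.
by rewrite IH; ring.
Qed.

Lemma size_le_legendre k : (size (legendre k) <= k.+1)%N.
Proof.
apply/leq_sizeP => i ki; rewrite !coefZ coef_derivn nth_default; last first.
  by rewrite -/u size_u; lia.
by rewrite mul0rn !mulr0.
Qed.

Lemma coef_legendre_gt0 k : 0 < (legendre k)`_k.
Proof.
rewrite !coefZ coef_derivn addnn -mul2n -/u.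
have := monic_exp k u_monic; rewrite monicE lead_coefE size_u /= => /eqP ->.
rewrite !mulr_gt0 ?sqrtr_gt0 ?invr_gt0 ?mulr_gt0 ?invr_gt0 ?ltr0n ?addn1 //.
  by rewrite muln_gt0 expn_gt0 fact_gt0.
by rewrite ffact_gt0; lia.
Qed.

Lemma size_legendre k : size (legendre k) = k.+1.
Proof.
apply/eqP; rewrite eqn_leq size_le_legendre /= ltnNge; apply/negP => sk.
by have := coef_legendre_gt0 k; rewrite nth_default ?ltxx.
Qed.

Lemma lead_coef_legendre_gt0 k : 0 < lead_coef (legendre k).
Proof. by rewrite lead_coefE size_legendre coef_legendre_gt0. Qed.

Lemma derivn_u_full n : (u ^+ n)^`(2 * n) = ((2 * n)`!)%:R%:P.
Proof.
apply/polyP => i; rewrite coef_derivn coefC; case: i => [|i].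
  rewrite addn0 ffactnn; have := monic_exp n u_monic.
  by rewrite monicE lead_coefE size_u /= => /eqP ->.
by rewrite nth_default ?mul0rn // size_u addnS ltnS leq_addr.
Qed.

Lemma legendre_orth_le k l : (l <= k)%N ->
  pint (legendre k * legendre l) = (k == l)%:R.
Proof.
move=> lk; rewrite /legendre -/u -!scalerAl -!scalerAr !pintZ.
rewrite (pint_u _ (leqnn k)) subnn derivn0.
have -> : (u ^+ l)^`(l)^`(k) = (u ^+ l)^`(k + l) by rewrite /derivn iterD.
have [<-|kl] := eqVneq k l; last first.
  rewrite derivn_poly0; last by rewrite size_u; lia.
  by rewrite mulr0 -(scale0r 0) pintZ mul0r !mulr0.
rewrite addnn -mul2n derivn_u_full [_ * _%:P]mulrC mul_polyC pintZ.
set s := Num.sqrt _; set b := (2 ^ k * _)%:R.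
have b0 : b != 0 by rewrite pnatr_eq0 -lt0n muln_gt0 expn_gt0 fact_gt0.
have d0 : (2 * k).+1%:R != 0 :> R by rewrite pnatr_eq0.
have := pint_un k; rewrite factS natrM -/b => H.
have ss : s * s = (2 * k).+1%:R / 2.
  by rewrite -expr2 sqr_sqrtr ?addn1 // divr_ge0.
move: b0 d0 H ss; move: (_.+1%:R) (_`!%:R) b s => d f b s b0 d0 H ss.
transitivity (s * s / b ^+ 2 * ((-1) ^+ k * pint (u ^+ k) * (d * f)) / d).
  by field; rewrite b0 d0.
by rewrite H ss /= mulr1n; field; rewrite d0 b0.
Qed.

Lemma legendre_orthonormal k l :
  \int[lebesgue_measure]_(x in `[-1, 1]) ((legendre k).[x] * (legendre l).[x])
  = (k == l)%:R.
Proof.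
have -> : \int[lebesgue_measure]_(x in `[-1, 1])
    ((legendre k).[x] * (legendre l).[x]) = pint (legendre k * legendre l).
  by apply: eq_Rintegral => x _; rewrite hornerM.
have [lk|/ltnW kl] := leqP l k; first exact: legendre_orth_le.
by rewrite mulrC eq_sym; exact: legendre_orth_le.
Qed.
End Legendre.

Section Coefficients.
Variable R : realType.

Definition Theta (x : R) : R := if 0 <= x then 1 else 0.

Definition tcoef (k l : nat) : R :=
  \int[lebesgue_measure]_(tau in `[-1, 1])
    \int[lebesgue_measure]_(rho in `[-1, 1])
      (Theta (tau - rho) * (legendre R k).[tau] * (legendre R l).[rho]).

Definition Tmx (M : nat) : 'M[R]_M :=
  \matrix_(k, l) if (k < M.-1)%N then tcoef k l else 0.

Definition That (M k l : nat) : R :=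
  match insub k, insub l with
  | Some i, Some j => Tmx M i j
  | _, _ => 0
  end.

Definition phi (M : nat) (t : R) : 'cV[R]_M := \col_k (legendre R k).[t].

Definition unit1 (M : nat) : 'cV[R]_M := \col_k (k == 0%N :> nat)%:R.

End Coefficients.

(* A vector of C^N (x) l^2 is a doubly indexed family [x i k], [i : 'I_N],      *)
(* [k : nat], with [ell2norm x < +oo].                                          *)
Section TensorEll2.
Variables (R : realType) (N : nat).

Definition tensvec := 'I_N -> nat -> R[i].

Definition ell2norm (x : tensvec) : \bar R :=
  sqrte (\sum_(0 <= k <oo) (\sum_(i < N) Normc.normc (x i k) ^+ 2)%:E)%E.

Definition ell2 : set tensvec := [set x | ell2norm x < +oo]%E.

(* The entry of [A (x) T] at row (i, k) and column (j, l) is [A i j * T k l]. *)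
Definition tensop (A : 'M[R[i]]_N) (T : nat -> nat -> R) (x : tensvec) : tensvec :=
  fun i k => \sum_(j < N) A i j * limn (series (fun l => (T k l)%:C * x j l)).

Definition opnorm (F : tensvec -> tensvec) : \bar R :=
  ereal_sup [set ell2norm (F y) | y in [set y | ell2norm y <= 1]%E].

(* (I - A (x) T)^-1: the inverse of I - A (x) T as a map on [ell2].             *)
Definition resolvent (A : 'M[R[i]]_N) (T : nat -> nat -> R) : tensvec -> tensvec :=
  'pinv_(fun=> fun=> fun=> 0) ell2 (fun x i k => x i k - tensop A T x i k).

End TensorEll2.

Section Bounds.
Variables (R : realType) (N M : nat).
Implicit Types (A : 'M[R[i]]_N) (c : R[i]).

Definition cplxmx m n (B : 'M[R]_(m, n)) : 'M[R[i]]_(m, n) :=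
  map_mx (real_complex R) B.

Definition ATmx A : 'M[R[i]]_(N * M) := A *t cplxmx (Tmx R M).

(* [castmx] only identifies the sizes [N * 1] and [N]. *)
Definition legendre_approx A (t : R) : 'M[R[i]]_N :=
  castmx (muln1 N, muln1 N)
    (((1%:M : 'M[R[i]]_N) *t (cplxmx (phi M t))^T)
     *m invmx (1%:M - ATmx A)
     *m ((1%:M : 'M[R[i]]_N) *t cplxmx (Num.sqrt 2 *: unit1 R M))).

Definition mu A c : R :=
  expR (Num.sqrt (9 * specradius A / (M.-1%:R * Normc.normc c))).

Definition resolvent_norm A : \bar R := opnorm (resolvent A (That R M)).

(* In [\bar R], [0^-1 = +oo]. *)
Definition Kconst A c : \bar R :=
  ((`|(Normc.normc (1 - c) - Normc.normc c * mu A c) * M%:R|%:E)^-1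
   + 28%:E * resolvent_norm A)%E.

End Bounds.

(* Main.v *)
Require Import Defs.
From HB Require Import structures.
From mathcomp Require Import all_boot all_order all_algebra.
From mathcomp Require Import complex mxtens.
From mathcomp Require Import all_classical all_reals all_analysis.
From mathcomp Require Import ring lra zify polyrcf.

Set Implicit Arguments.
Unset Strict Implicit.
Unset Printing Implicit Defensive.

Import Order.TTheory GRing.Theory Num.Theory.
Import numFieldNormedType.Exports.

Local Open Scope classical_set_scope.
Local Open Scope ring_scope.
Local Open Scope complex_scope.

(* Put n = M - 1 and q_j(t) = (t + 1)^j / j!, with Legendre coefficient vector   *)
(* v_j. Since T_M integrates from -1 and then drops the coefficients of index   *)
(* >= n, one has T_M v_j = v_(j+1) for j < n - 1, and the sum of A^j (x) v_j      *)
(* over j < n solves the linear system up to the residual A^n (x) w with        *)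
(* w = T_M v_(n-1). The approximation is therefore the Taylor polynomial of     *)
(* degree n - 1 of exp(A(t+1)) plus (I (x) phi^T)(I - A (x) T_M)^-1 (A^n (x) w). *)
(* As |phi(t)| <= M / sqrt 2 and, by Bessel, |w| <= sqrt 2 * 2^n / n!, the error *)
(* is at most kappa(Z) (M ||(I - A (x) T_M)^-1|| + 2) (2 rho)^n / n!.             *)
(* The zero last row of T_M turns the convergence of the Taylor series into     *)
(* |c| < |1 - c|; if r = |c mu / (1 - c)| < 1, then r >= 9 rho / n whatever the  *)
(* centre c, and (2 rho)^n / n! <= (2 e rho / n)^n <= r^n.                        *)

(** * Legendre polynomials *)

(** The error has two parts of the same order. [T_M] is exact integration on [tpoly j] until the
    degree reaches the zeroed row ([Tmx_tvecS]), so applying I - A (x) T_M to a truncated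
    exponential series telescopes ([resolvent_taylor]). By [legendre_approx_expansion] the
    approximation is then a Taylor polynomial of exp(A(t+1)) plus a single resolvent term.
    [exp_remainder] bounds the missing Taylor tail through the eigenvalues. [contract_remainder]
    bounds the resolvent term, with [sum_legendre_sqr_le] controlling phi, [Tmx_tvec_norm] the
    residual, and [enorm_resolvent] passing from the finite inverse to the operator on the sequence
    space. What is left compares (2 rho)^n / n! with r^n, where r = |c mu / (1 - c)|. Given |c| < |1
    - c| ([taylor_expandable_normc_lt]), the hypothesis on M says exactly that r <= 1. If r = 1,
    then K_M is infinite and the bound is trivial. If r < 1, then [ratio_ge] and [factorial_bound]
    conclude. Where the sections below write [M] for [n.+2], the exponent M - 1 is [n.+1]. *)

Section LegendreBound.
Variable R : realType.
Implicit Types p q : {poly R}.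
Local Notation u := ('X ^+ 2 - 1 : {poly R}).

Lemma deriv_u : u^`() = 'X *+ 2.
Proof. by rewrite derivB derivXn -[1]/(1%:P) derivC subr0 expr1. Qed.

Lemma deriv_natl n p : (n%:R * p)^`() = n%:R * p^`().
Proof. by rewrite mulr_natl derivMn mulr_natl. Qed.

(** For w = u^k one has u w' = 2 k x w; this is that identity differentiated j + 1 times. At j = k
    it is Legendre's equation for the Rodrigues polynomial. *)
Lemma derivn_u_ode k j :
  u * (u ^+ k)^`(j.+2) =
    (2 * k)%:R * ('X * (u ^+ k)^`(j.+1)) - (2 * j.+1)%:R * ('X * (u ^+ k)^`(j.+1))
    + (2 * k * j.+1)%:R * (u ^+ k)^`(j) - (j * j.+1)%:R * (u ^+ k)^`(j).
Proof.
have H : u * (u ^+ k)^`(1) = (2 * k)%:R * ('X * u ^+ k).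
  rewrite derivn1 deriv_exp deriv_u; case: k => [|k] /=.
    by rewrite mulr0n mulr0 mul0r.
  rewrite [_ ^+ k.+1]exprS -[in LHS]mulr_natl natrM.
  by move: (u ^+ k) u (k.+1%:R : {poly R}) (polyX R) => a b c d; ring.
elim: j => [|j IH].
  have := congr1 (@deriv R) H; rewrite derivM deriv_natl derivM derivX deriv_u.
  rewrite !natrM -!derivnS -[(u ^+ k)^`()]derivn1 derivn0.
  move: ((u ^+ k)^`(2)) ((u ^+ k)^`(1)) (u ^+ k) (polyX R) u (k%:R : {poly R}) => a b c d e f.
  by move=> /eqP; rewrite -subr_eq0 => /eqP E; apply/subr0_eq; rewrite -[RHS]E; ring.
have := congr1 (@deriv R) IH; rewrite derivM deriv_u !(derivB, derivD, deriv_natl).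
rewrite !derivM derivX -!derivnS !natrM -!natr1.
move: ((u ^+ k)^`(j.+3)) ((u ^+ k)^`(j.+2)) ((u ^+ k)^`(j.+1)) ((u ^+ k)^`(j)).
move: (polyX R) u (k%:R : {poly R}) (j%:R : {poly R}).
move=> e f g h a b c d.
move=> /eqP; rewrite -subr_eq0 => /eqP E.
by apply/subr0_eq; rewrite -[RHS]E; ring.
Qed.

(** Each derivative strips off one factor u, whose own derivative is 2 or -2 at the ends, and brings
    down the remaining exponent. At j = k this yields the end values (2)^k k! and (-2)^k k! used in
    [sonin_bound]. *)
Lemma derivn_u_ends k j : (j <= k)%N ->
  exists q, [/\ (u ^+ k)^`(j) = u ^+ (k - j) * q,
    q.[1] = 2 ^+ j * (k ^_ j)%:R & q.[-1] = (- 2) ^+ j * (k ^_ j)%:R].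
Proof.
elim: j => [|j IH] jk.
  by exists 1; rewrite subn0 mulr1 !hornerE /=; split=> //; rewrite ?ffactn0 ?mulr1.
have [q [qE q1 qN1]] := IH (ltnW jk).
exists ((2 * (k - j)%:R) * ('X * q) + u * deriv q); split.
- rewrite derivnS qE derivM deriv_exp deriv_u -(subnSK jk) [u ^+ _.+1]exprS /=.
  rewrite -[X in X * q + _]mulr_natl.
  by move: (_ ^+ (k - j.+1)) ((k - j.+1).+1%:R : {poly R}) (q^`()) => b d e; ring.
- rewrite hornerD !hornerM u1 mul0r addr0 hornerX q1 ffactnSr natrM exprS.
  by rewrite -!polyC_natr !hornerC; move: (_ ^+ _) => a; ring.
- rewrite hornerD !hornerM uN1 mul0r addr0 hornerX qN1 ffactnSr natrM exprS.
  by rewrite -!polyC_natr !hornerC; move: (_ ^+ _) => a; ring.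
Qed.

(* Sonin: by Legendre's equation, [k (k + 1) y^2 + (1 - x^2) y'^2] has the       *)
(* derivative [2 x y'^2], so it is largest at the ends of the interval.          *)
Lemma sonin_bound k (t : R) : -1 <= t <= 1 ->
  ((u ^+ k)^`(k)).[t] ^+ 2 <= ((2 ^ k * k`!)%:R) ^+ 2.
Proof.
case: k => [|k] /andP[t1 t2]; first by rewrite expr0 derivn0 hornerC.
set y := (u ^+ k.+1)^`(k.+1); set c : R := (k.+1 * k.+2)%:R.
have c0 : 0 < c by rewrite ltr0n.
pose F := c *: (y * y) - u * (y^`() * y^`()).
have FE x : F^`().[x] = 2 * x * y^`().[x] ^+ 2.
  have := congr1 (fun p => p.[x]) (derivn_u_ode k.+1 k.+1 :
    u * y^`()^`() = (2 * k.+1)%:R * ('X * y^`()) - (2 * k.+2)%:R * ('X * y^`())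
      + (2 * k.+1 * k.+2)%:R * y - (k.+1 * k.+2)%:R * y).
  rewrite /F derivB derivZ !derivM deriv_u.
  rewrite -!(polyC_natr _ (_ * _)) !(hornerE, hornerMn) -/c /= => H.
  have c2 : (2 * k.+1 * k.+2)%:R = 2 * c by rewrite -mulnA natrM.
  have k2 : (2 * k.+2)%:R = (2 * k.+1)%:R + 2 :> R by rewrite -natrD; congr (_%:R); lia.
  move: H; rewrite c2 k2; move: (c) y^`()^`().[x] y^`().[x] y.[x] (2 * k.+1)%:R.
  move=> b y2 y1 y0 a /eqP; rewrite -subr_eq0 => /eqP H.
  apply/subr0_eq; rewrite -[RHS](mulr0 (- 2 * y1)) -H; ring.
have y1 : y.[1] ^+ 2 = (2 ^ k.+1 * (k.+1)`!)%:R ^+ 2.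
  have [q [E q1 _]] := derivn_u_ends (leqnn k.+1).
  by rewrite /y E subnn expr0 mul1r q1 ffactnn natrM natrX.
have yN1 : y.[-1] ^+ 2 = (2 ^ k.+1 * (k.+1)`!)%:R ^+ 2.
  have [q [E _ qN1]] := derivn_u_ends (leqnn k.+1).
  by rewrite /y E subnn expr0 mul1r qN1 ffactnn natrM natrX !exprMn exprAC sqrrN exprAC.
have F0 x : F.[x] = c * y.[x] ^+ 2 - (x ^+ 2 - 1) * y^`().[x] ^+ 2.
  by rewrite /F !hornerE.
have Fy : c * y.[t] ^+ 2 <= F.[t].
  by rewrite F0 lerDl oppr_ge0 mulr_le0_ge0 ?sqr_ge0 //; nra.
have F1 : c * y.[1] ^+ 2 = F.[1] by rewrite F0; ring.
have FN1 : c * y.[-1] ^+ 2 = F.[-1] by rewrite F0; ring.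
rewrite -(ler_pM2l c0); apply: le_trans Fy _.
(* The derivative of [F] has the sign of x, so [F] grows away from 0: the mean value theorem
   compares t with the end of the interval on its own side. *)
have [t0|t0] := lerP 0 t.
- rewrite -y1 F1; have [->//|tn1] := eqVneq t 1.
  have [|z /[!in_itv]/= /andP[z1 z2] H] := @poly_mvt _ t 1 F.
    by rewrite lt_neqAle tn1.
  rewrite -subr_ge0 H FE mulr_ge0 ?subr_ge0 // mulr_ge0 ?sqr_ge0 //.
  by rewrite mulr_ge0 // (le_trans t0) // ltW.
- rewrite -yN1 FN1; have [->//|tn1] := eqVneq t (-1).
  have [|z /[!in_itv]/= /andP[z1 z2] H] := @poly_mvt _ (-1) t F.
    by rewrite lt_neqAle eq_sym tn1.
  rewrite -subr_le0 H FE mulr_le0_ge0 ?subr_ge0 // mulr_le0_ge0 ?sqr_ge0 //.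
  by rewrite pmulr_rle0 // (le_trans (ltW z2)) // ltW.
Qed.

Lemma legendre_sqr_le k (t : R) : -1 <= t <= 1 ->
  (legendre R k).[t] ^+ 2 <= (2 * k + 1)%:R / 2.
Proof.
move=> t1; rewrite !hornerZ !exprMn sqr_sqrtr ?divr_ge0 //.
rewrite ler_piMr ?divr_ge0 // exprVn ler_pdivrMl ?mulr1 ?sonin_bound //.
Qed.

(** The odd numbers 1, 3, ..., 2M - 1 add up to M^2. *)
Lemma sum_legendre_sqr_le M (t : R) : -1 <= t <= 1 ->
  \sum_(k < M) (legendre R k).[t] ^+ 2 <= M%:R ^+ 2 / 2.
Proof.
move=> t1; elim: M => [|M IH]; first by rewrite big_ord0 expr0n mul0r.
rewrite big_ord_recr /=; apply: le_trans (lerD IH (legendre_sqr_le M t1)) _.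
by rewrite natrD natrM -natr1; lra.
Qed.

End LegendreBound.

(** * Legendre expansions, Bessel's inequality and integration in Legendre coordinates *)

Section LegendreCoefficients.
Variable R : realType.
Implicit Types p q : {poly R}.

Definition lcoef q k := pint (legendre R k * q).

Lemma pint_ge0 p : (forall x : R, -1 <= x <= 1 -> 0 <= p.[x]) -> 0 <= pint p.
Proof. by move=> p0; apply: Rintegral_ge0 => x /=; rewrite in_itv /= => /p0. Qed.

Lemma pint0 : pint 0 = 0 :> R.
Proof. by rewrite -(scale0r 0) pintZ mul0r. Qed.

Lemma pint_sum I (r : seq I) (F : I -> {poly R}) :
  pint (\sum_(i <- r) F i) = \sum_(i <- r) pint (F i).
Proof. exact: (big_morph (@pint R) (@pintD R) pint0). Qed.

Lemma pint_legendre k l : pint (legendre R k * legendre R l) = (k == l)%:R.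
Proof.
have [lk|/ltnW kl] := leqP l k; first exact: legendre_orth_le.
by rewrite mulrC eq_sym; exact: legendre_orth_le.
Qed.

Lemma legendre_span M q : (size q <= M)%N ->
  exists a : nat -> R, q = \sum_(k < M) a k *: legendre R k.
Proof.
elim: M q => [|M IH] q sq.
  by exists (fun=> 0); rewrite big_ord0; apply/eqP; rewrite -size_poly_leq0.
pose c := q`_M / (legendre R M)`_M.
have [|a aE] := IH (q - c *: legendre R M).
  apply/leq_sizeP => j; rewrite leq_eqVlt => /predU1P[<-|Mj].
    by rewrite coefB coefZ divfK ?subrr // gt_eqF ?coef_legendre_gt0.
  rewrite coefB coefZ !nth_default ?mulr0 ?subrr ?size_legendre //.
  exact: leq_trans sq Mj.
exists (fun k => if k == M then c else a k).
rewrite big_ord_recr /= eqxx -[LHS](subrK (c *: legendre R M)) aE; congr (_ + _).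
by apply: eq_bigr => i _; rewrite ltn_eqF.
Qed.

Lemma lcoef_sum M (a : nat -> R) k :
  lcoef (\sum_(l < M) a l *: legendre R l) k = if (k < M)%N then a k else 0.
Proof.
rewrite /lcoef mulr_sumr pint_sum.
under eq_bigr do rewrite -scalerAr pintZ pint_legendre.
case: ltnP => [kM|Mk].
  rewrite (bigD1 (Ordinal kM)) //= eqxx mulr1 big1 ?addr0 // => l lk.
  by rewrite (_ : (k == l) = false) ?mulr0 //; apply/negbTE; rewrite eq_sym.
by rewrite big1 // => l _; rewrite gtn_eqF ?mulr0 //; apply: leq_trans Mk.
Qed.

Lemma legendre_expansion M q : (size q <= M)%N ->
  q = \sum_(k < M) lcoef q k *: legendre R k.
Proof.
move=> /legendre_span[a qE]; rewrite {1}qE; apply: eq_bigr => k _.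
by rewrite qE lcoef_sum ltn_ord.
Qed.

Lemma lcoef_eq0 q k : (size q <= k)%N -> lcoef q k = 0.
Proof. by move=> /legendre_span[a ->]; rewrite lcoef_sum ltnn. Qed.

(** The integral of (q - S)^2 is nonnegative, S being the truncated expansion of q; orthonormality
    evaluates it. *)
Lemma bessel M q : \sum_(k < M) lcoef q k ^+ 2 <= pint (q * q).
Proof.
set S := \sum_(k < M) lcoef q k *: legendre R k.
have Sq : pint (S * q) = \sum_(k < M) lcoef q k ^+ 2.
  by rewrite mulr_suml pint_sum; apply: eq_bigr => k _; rewrite -scalerAl pintZ.
have SS : pint (S * S) = \sum_(k < M) lcoef q k ^+ 2.
  rewrite {1}/S mulr_suml pint_sum; apply: eq_bigr => k _.
  by rewrite -scalerAl pintZ -[pint _]/(lcoef S k) lcoef_sum ltn_ord.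
have : 0 <= pint ((q - S) * (q - S)).
  by apply: pint_ge0 => x _; rewrite hornerM -expr2 sqr_ge0.
have -> : (q - S) * (q - S) = q * q + (-2) *: (S * q) + S * S.
  by rewrite -mul_polyC polyCN; move: (2%:P) (polyC_natr R 2) => b ->; ring.
by rewrite !pintD pintZ Sq SS; lra.
Qed.

Lemma pint_onep_exp n :
  pint (('X + 1) ^+ n * ('X + 1) ^+ n) = 2 ^+ (2 * n).+1 / (2 * n).+1%:R :> R.
Proof.
have n0 : (2 * n).+1%:R != 0 :> R by rewrite pnatr_eq0.
have -> : ('X + 1) ^+ n * ('X + 1) ^+ n =
    deriv ((2 * n).+1%:R^-1 *: ('X + 1) ^+ (2 * n).+1) :> {poly R}.
  rewrite derivZ deriv_exp derivD derivX -[1]/(1%:P) derivC addr0 mul1r /=.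
  rewrite -[_ ^+ (2 * n) *+ _]scaler_nat [RHS]scalerA mulVf // scale1r.
  by rewrite -exprD mul2n addnn.
by rewrite pint_deriv !hornerE addNr expr0n /= mulr0 subr0 mulrC.
Qed.

Lemma deriv_inj p q : p^`() = q^`() -> p.[-1] = q.[-1] -> p = q.
Proof.
move=> d e; apply/subr0_eq; have : (p - q)^`() = 0 by rewrite derivB d subrr.
have : (p - q).[-1] = 0 by rewrite hornerD hornerN e subrr.
move: (p - q : {poly R}) => r r1 r0; suff rE : r = (r`_0)%:P.
  by rewrite rE in r1 *; move: r1; rewrite hornerC => ->.
apply/polyP => -[|i]; rewrite coefC //=.
have := congr1 (fun p => p`_i) r0; rewrite coef_deriv coef0 => /eqP.
by rewrite mulrn_eq0 /= => /eqP.
Qed.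

(** The factor [Theta] cuts the inner integral down to [-1, tau], where the fundamental theorem of
    calculus gives P(tau). *)
Lemma tcoef_pint k l P : P^`() = legendre R l -> P.[-1] = 0 ->
  tcoef R k l = pint (legendre R k * P).
Proof.
move=> dP P1; apply: eq_Rintegral => tau; rewrite inE /= in_itv /= => /andP[t1 t2].
rewrite hornerM.
transitivity (\int[lebesgue_measure]_(rho in `[-1, tau])
  (deriv ((legendre R k).[tau] *: P)).[rho]).
  have -> : `[-1, tau]%classic = `[-1, 1] `&` `]-oo, tau] :> set R.
    apply/seteqP; split=> x /=; rewrite !in_itv /= ?andbT.
      by move=> /andP[-> xt]; rewrite xt (le_trans xt t2).
    by move=> [/andP[-> _] ->].
  rewrite Rintegral_mkcondr; apply: eq_Rintegral => rho _.
  rewrite patchE /Theta subr_ge0 mem_setE in_itv /= derivZ dP hornerZ.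
  by case: ifP; rewrite ?mul1r ?mul0r.
(* [continuous_FTC2] asks for a nondegenerate interval; at tau = -1 both sides vanish. *)
have [t0|t0] := eqVneq tau (-1).
  by rewrite t0 set_itv1 Rintegral_set1 P1 mulr0.
rewrite /Rintegral (@continuous_FTC2 R (horner (deriv ((legendre R k).[tau] *: P)))
   (horner ((legendre R k).[tau] *: P))) //.
- by rewrite !hornerZ P1 mulr0 sube0.
- by rewrite lt_neqAle eq_sym t0.
- exact/continuous_subspaceT/continuous_horner.
- split; first by move=> x _; exact: derivable_horner.
  + exact/cvg_at_right_filter/continuous_horner.
  + exact/cvg_at_left_filter/continuous_horner.
- by move=> x _; rewrite derivE.
Qed.

(** The infinite matrix T is integration from -1 in Legendre coordinates. The degree bound makes the
    expansion of Q' finite, so M columns already give every row k exactly. *)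
Lemma tcoef_lcoef M Q k : Q.[-1] = 0 -> (size Q^`() <= M)%N ->
  \sum_(l < M) tcoef R k l * lcoef Q^`() l = lcoef Q k.
Proof.
move=> Q1 sQ.
have /choice[P PE] : forall l, exists P, P^`() = legendre R l /\ P.[-1] = 0.
  move=> l; have [P PE] := antideriv (legendre R l).
  by exists (P - P.[-1]%:P); rewrite derivB derivC subr0 hornerD hornerN hornerC subrr.
have QE : Q = \sum_(l < M) lcoef Q^`() l *: P l.
  apply: deriv_inj.
    rewrite [LHS](legendre_expansion sQ) raddf_sum /=; apply: eq_bigr => l _.
    by rewrite derivZ (PE l).1.
  by rewrite horner_sum Q1 big1 // => l _; rewrite hornerZ (PE l).2 mulr0.
rewrite [in RHS]QE [RHS]/lcoef mulr_sumr pint_sum; apply: eq_bigr => l _.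
by rewrite -scalerAr pintZ (tcoef_pint k (PE l).1 (PE l).2) mulrC.
Qed.

End LegendreCoefficients.

(** * Euclidean and spectral norms *)

Section Norms.
Variable R : realType.
Implicit Types (x y : R[i]).

Local Notation normc := Normc.normc.

Lemma normc_ge0 x : 0 <= normc x.
Proof. by case: x => a b; rewrite sqrtr_ge0. Qed.

Lemma normc_sum I (r : seq I) (F : I -> R[i]) :
  normc (\sum_(i <- r) F i) <= \sum_(i <- r) normc (F i).
Proof.
elim/big_ind2: _ => // [|x a y b xa yb]; first by rewrite Normc.normc0.
by apply: le_trans (le_normcD _ _) _; apply: lerD.
Qed.

Lemma normcX x k : normc (x ^+ k) = normc x ^+ k.
Proof.
elim: k => [|k IH]; first by rewrite !expr0 Normc.normc1.
by rewrite !exprS Normc.normcM IH.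
Qed.

Lemma normc_real (a : R) : normc a%:C = `|a|.
Proof. by rewrite /= expr0n addr0 sqrtr_sqr. Qed.

Lemma cauchy_schwarz (I : finType) (a b : I -> R) :
  (\sum_i a i * b i) ^+ 2 <= (\sum_i a i ^+ 2) * \sum_i b i ^+ 2.
Proof.
set A := \sum_i a i ^+ 2; set B := \sum_i b i ^+ 2; set C := \sum_i a i * b i.
have B0 : 0 <= B by apply: sumr_ge0 => i _; exact: sqr_ge0.
have key (s t : R) : 0 <= s ^+ 2 * A - 2 * s * t * C + t ^+ 2 * B.
  have -> : s ^+ 2 * A - 2 * s * t * C + t ^+ 2 * B = \sum_i (s * a i - t * b i) ^+ 2.
    rewrite !mulr_sumr -sumrB -big_split; apply: eq_bigr => i _ /=; ring.
  by apply: sumr_ge0 => i _; exact: sqr_ge0.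
have [B0'|Bn0] := eqVneq B 0.
  suff -> : C = 0 by rewrite B0' expr0n mulr0.
  rewrite /C big1 // => i _; have /eqP := B0'.
  rewrite psumr_eq0 => [/allP/(_ i)|j _]; last exact: sqr_ge0.
  by rewrite mem_index_enum sqrf_eq0 => /(_ isT) /= /eqP ->; rewrite mulr0.
(* Minimizing choice of the quadratic form: at s = B, t = C it factors as B (A B - C^2). *)
have := key B C.
have -> : B ^+ 2 * A - 2 * B * C * C + C ^+ 2 * B = B * (A * B - C ^+ 2) by ring.
by rewrite pmulr_rge0 ?subr_ge0 // lt_neqAle eq_sym Bn0.
Qed.

Lemma enorm_ge0 n (v : 'cV[R[i]]_n) : 0 <= enorm v.
Proof. exact: sqrtr_ge0. Qed.

Lemma sqr_enorm n (v : 'cV[R[i]]_n) : enorm v ^+ 2 = \sum_(i < n) normc (v i 0) ^+ 2.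
Proof. by rewrite sqr_sqrtr //; apply: sumr_ge0 => i _; exact: sqr_ge0. Qed.

Lemma enorm_le n (v : 'cV[R[i]]_n) B : 0 <= B ->
  \sum_(i < n) normc (v i 0) ^+ 2 <= B ^+ 2 -> enorm v <= B.
Proof. by move=> B0; rewrite -sqr_enorm ler_pXn2r ?nnegrE ?enorm_ge0. Qed.

Lemma normc_le_enorm n (v : 'cV[R[i]]_n) i : normc (v i 0) <= enorm v.
Proof.
rewrite -(@ler_pXn2r _ 2) ?nnegrE ?enorm_ge0 ?normc_ge0 // sqr_enorm (bigD1 i) //=.
by rewrite lerDl; apply: sumr_ge0 => j _; exact: sqr_ge0.
Qed.

Lemma enormD n (v w : 'cV[R[i]]_n) : enorm (v + w) <= enorm v + enorm w.
Proof.
apply: enorm_le; first by rewrite addr_ge0 ?enorm_ge0.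
apply: (@le_trans _ _ (\sum_i (normc (v i 0) + normc (w i 0)) ^+ 2)).
  apply: ler_sum => i _; rewrite mxE ler_pXn2r ?nnegrE ?addr_ge0 ?normc_ge0 //.
  exact: le_normcD.
have : \sum_i normc (v i 0) * normc (w i 0) <= enorm v * enorm w.
  rewrite -(@ler_pXn2r _ 2) ?nnegrE ?mulr_ge0 ?enorm_ge0 //; last first.
    by apply: sumr_ge0 => i _; rewrite mulr_ge0 ?normc_ge0.
  by rewrite exprMn !sqr_enorm; exact: cauchy_schwarz.
move=> cs; under eq_bigr do rewrite sqrrD.
by rewrite !big_split /= -!sqr_enorm; lra.
Qed.

Lemma enormZ n a (v : 'cV[R[i]]_n) : enorm (a *: v) = normc a * enorm v.
Proof.
rewrite /enorm; under eq_bigr do rewrite mxE Normc.normcM exprMn.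
by rewrite -mulr_sumr sqrtrM ?sqr_ge0 // sqrtr_sqr ger0_norm ?normc_ge0.
Qed.

Lemma enorm0 n : enorm (0 : 'cV[R[i]]_n) = 0.
Proof. by rewrite -(scale0r 0) enormZ Normc.normc0 mul0r. Qed.

Lemma enormN n (v : 'cV[R[i]]_n) : enorm (- v) = enorm v.
Proof. by rewrite -scaleN1r enormZ normcN Normc.normc1 mul1r. Qed.

Lemma enorm_eq0 n (v : 'cV[R[i]]_n) : enorm v = 0 -> v = 0.
Proof.
move=> v0; apply/matrixP => i j; rewrite ord1 mxE; apply: Normc.eq0_normc.
by apply/eqP; rewrite eq_le normc_ge0 -v0 normc_le_enorm.
Qed.

(** The Frobenius norm serves as the upper bound that makes the supremum in [specnorm] a genuine
    one. *)
Lemma enorm_mulmx_frobenius m n (A : 'M[R[i]]_(m, n)) v :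
  enorm (A *m v) <= Num.sqrt (\sum_i \sum_j normc (A i j) ^+ 2) * enorm v.
Proof.
apply: enorm_le; first by rewrite mulr_ge0 ?sqrtr_ge0 ?enorm_ge0.
rewrite exprMn sqr_sqrtr; last first.
  by apply: sumr_ge0 => i _; apply: sumr_ge0 => j _; exact: sqr_ge0.
rewrite mulr_suml sqr_enorm; apply: ler_sum => i _; rewrite mxE.
apply: le_trans (cauchy_schwarz _ _); rewrite ler_pXn2r ?nnegrE ?normc_ge0 //; last first.
  by apply: sumr_ge0 => j _; rewrite mulr_ge0 ?normc_ge0.
by apply: le_trans (normc_sum _ _) _; apply: ler_sum => j _; rewrite Normc.normcM.
Qed.

Lemma specnorm_ub m n (A : 'M[R[i]]_(m, n)) v : enorm v <= 1 ->
  enorm (A *m v) <= specnorm A.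
Proof.
move=> v1; apply: ub_le_sup; last by exists v.
exists (Num.sqrt (\sum_i \sum_j normc (A i j) ^+ 2)) => _ [w w1 <-].
by apply: le_trans (enorm_mulmx_frobenius _ _) _; rewrite ler_piMr ?sqrtr_ge0.
Qed.

Lemma specnorm_ge0 m n (A : 'M[R[i]]_(m, n)) : 0 <= specnorm A.
Proof.
by apply: le_trans (@specnorm_ub _ _ A 0 _); rewrite ?enorm0 ?ler01 ?enorm_ge0.
Qed.

Lemma enorm_mulmx m n (A : 'M[R[i]]_(m, n)) v :
  enorm (A *m v) <= specnorm A * enorm v.
Proof.
have [/enorm_eq0 ->|v0] := eqVneq (enorm v) 0; first by rewrite mulmx0 !enorm0 mulr0.
have vp : 0 < enorm v by rewrite lt_neqAle eq_sym v0 enorm_ge0.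
have := @specnorm_ub _ _ A ((enorm v)^-1%:C *: v).
rewrite -scalemxAr !enormZ normc_real ger0_norm ?invr_ge0 ?enorm_ge0 //.
by rewrite mulVf // mulrC => /(_ (lexx _)); rewrite ler_pdivrMr.
Qed.

Lemma specnorm_le m n (A : 'M[R[i]]_(m, n)) B :
  (forall v, enorm v <= 1 -> enorm (A *m v) <= B) -> specnorm A <= B.
Proof.
move=> AB; apply: ge_sup => [|_ [v v1 <-]]; last exact: AB.
by exists (enorm (A *m 0)), 0 => //=; rewrite enorm0 ler01.
Qed.

Lemma cond_ge1 n (Z : 'M[R[i]]_n) : (0 < n)%N -> Z \in unitmx -> 1 <= cond Z.
Proof.
case: n Z => // n Z _ uZ; pose e : 'cV[R[i]]_n.+1 := delta_mx 0 0.
have e0 : enorm e != 0.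
  apply/eqP => /enorm_eq0 /matrixP/(_ 0 0); rewrite !mxE eqxx /= => /eqP.
  by rewrite oner_eq0.
have ep : 0 < enorm e by rewrite lt_neqAle eq_sym e0 enorm_ge0.
rewrite -(ler_pM2r ep) mul1r -{1}[e]mul1mx -(mulmxV uZ) -mulmxA -mulrA.
apply: le_trans (enorm_mulmx _ _) _; apply: ler_wpM2l; first exact: specnorm_ge0.
exact: enorm_mulmx.
Qed.

Lemma enorm_diag n (d : 'rV[R[i]]_n) (v : 'cV_n) B :
  0 <= B -> (forall i, normc (d 0 i) <= B) ->
  enorm (diag_mx d *m v) <= B * enorm v.
Proof.
move=> B0 dB; apply: enorm_le; first by rewrite mulr_ge0 ?enorm_ge0.
rewrite exprMn sqr_enorm mulr_sumr; apply: ler_sum => i _.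
rewrite mul_diag_mx mxE Normc.normcM exprMn ler_wpM2r ?sqr_ge0 //.
by rewrite ler_pXn2r ?nnegrE ?normc_ge0 ?dB.
Qed.

Lemma enorm_diagonalizable n (Z : 'M[R[i]]_n) (d : 'rV[R[i]]_n) (v : 'cV_n) B :
  0 <= B -> (forall i, normc (d 0 i) <= B) ->
  enorm (Z *m diag_mx d *m invmx Z *m v) <= cond Z * B * enorm v.
Proof.
move=> B0 dB; rewrite -!mulmxA.
apply: le_trans (enorm_mulmx _ _) _; rewrite /cond -!mulrA.
apply: ler_wpM2l; first exact: specnorm_ge0.
apply: le_trans (enorm_diag _ B0 dB) _; rewrite mulrCA.
by apply: ler_wpM2l => //; exact: enorm_mulmx.
Qed.

(** [eigenvalue] refers to row eigenvectors, and the rows of the inverse of Z are such vectors. *)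
Lemma specradius_diag n (Z : 'M[R[i]]_n) (d : 'rV[R[i]]_n) i : Z \in unitmx ->
  normc (d 0 i) <= specradius (Z *m diag_mx d *m invmx Z).
Proof.
move=> uZ; apply: ub_le_sup; last first.
  exists (d 0 i) => //=; apply/eigenvalueP; exists (row i (invmx Z)); last first.
    apply/negP => /eqP /(congr1 (mulmx^~ Z)); rewrite mul0mx -row_mul mulVmx //.
    by move=> /matrixP/(_ 0 i); rewrite !mxE eqxx => /eqP; rewrite oner_eq0.
  rewrite !mulmxA -!row_mul mulVmx // mul1mx.
  by apply/matrixP => a b; rewrite row_mul row_diag_mx -scalemxAl -rowE.
(* The supremum needs a bounded set: v Z is a nonzero eigenvector of the diagonal matrix, so the
   eigenvalue a is one of the entries of d. *)
exists (\sum_j normc (d 0 j)) => _ [a /eigenvalueP[v vE v0] <-].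
have [j vj] : exists j, (v *m Z) 0 j != 0.
  apply: contrapT => H; move/negP: v0; apply; rewrite -(mulmxK uZ v).
  rewrite (_ : v *m Z = 0) ?mul0mx //; apply/matrixP => x y; rewrite ord1 [RHS]mxE.
  by apply/eqP/negPn/negP => h; apply: H; exists y.
have : v *m Z *m diag_mx d = a *: (v *m Z).
  by rewrite scalemxAl -vE !mulmxA mulmxKV.
move=> /matrixP/(_ 0 j); rewrite mul_mx_diag [LHS]mxE [RHS]mxE mulrC => /(mulIf vj) <-.
rewrite (bigD1 j) //= lerDl; apply: sumr_ge0 => k _; exact: normc_ge0.
Qed.

End Norms.

(** * The truncated linear system *)

Section TaylorCoefficients.
Variable R : realType.

(** The Taylor monomials at -1: integration from -1 sends each one to the next. *)
Definition tpoly j : {poly R} := (j`!%:R)^-1 *: ('X + 1) ^+ j.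

Lemma deriv_tpoly j : (tpoly j.+1)^`() = tpoly j.
Proof.
rewrite derivZ deriv_exp derivD derivX -polyC1 derivC polyC1 addr0 mul1r /=.
rewrite -[_ *+ j.+1]scaler_nat [LHS]scalerA; congr (_ *: _).
by rewrite factS natrM invfM mulrAC mulVf ?mul1r // pnatr_eq0.
Qed.

Lemma tpoly_N1 j : (tpoly j.+1).[-1] = 0.
Proof. by rewrite !hornerE addNr expr0n /= mulr0. Qed.

Lemma size_tpoly j : (size (tpoly j) <= j.+1)%N.
Proof.
apply: leq_trans (size_scale_leq _ _) _.
by rewrite -[1]opprK -polyCN size_exp_XsubC.
Qed.

Lemma horner_tpoly j t : (tpoly j).[t] = (t + 1) ^+ j / j`!%:R.
Proof. by rewrite !hornerE mulrC. Qed.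

Definition tvec M j : 'cV[R]_M := \col_k lcoef (tpoly j) k.

Lemma legendre0 : legendre R 0 = (Num.sqrt 2)^-1%:P.
Proof.
by rewrite /legendre expr0 derivn0 fact0 !muln1 invr1 scale1r div1r sqrtrV ?alg_polyC.
Qed.

Lemma tvec0 M : tvec M 0 = Num.sqrt 2 *: unit1 R M.
Proof.
apply/matrixP => k l; rewrite !mxE.
have -> : tpoly 0 = Num.sqrt 2 *: legendre R 0.
  rewrite legendre0 scale_polyC /tpoly.
  by rewrite expr0 fact0 invr1 scale1r divff // gt_eqF // sqrtr_gt0.
by rewrite /lcoef -scalerAr pintZ pint_legendre.
Qed.

Lemma phi_tvec M j t : (j < M)%N -> (phi M t)^T *m tvec M j = ((tpoly j).[t])%:M.
Proof.
move=> jM; apply/matrixP => a b; rewrite !ord1 !mxE eqxx mulr1n.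
rewrite [in RHS](legendre_expansion (leq_trans (size_tpoly j) jM)).
by rewrite horner_sum; apply: eq_bigr => k _; rewrite !mxE [RHS]hornerZ mulrC.
Qed.

Lemma Tmx_tvec n j k : (j < n.+1)%N ->
  (Tmx R n.+1 *m tvec n.+1 j) k 0 = if (k < n)%N then lcoef (tpoly j.+1) k else 0.
Proof.
move=> jn; rewrite !mxE; under eq_bigr do rewrite !mxE.
case: ifP => _; last by apply: big1 => l _; rewrite mul0r.
rewrite -(@tcoef_lcoef _ n.+1 (tpoly j.+1)) ?tpoly_N1 ?deriv_tpoly //.
exact: leq_trans (size_tpoly j) jn.
Qed.

(** The zeroed row has index n, and [tpoly j.+1] has degree below n, so the entry that is dropped
    was 0 anyway. *)
Lemma Tmx_tvecS n j : (j.+1 < n)%N -> Tmx R n.+1 *m tvec n.+1 j = tvec n.+1 j.+1.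
Proof.
move=> jn; apply/matrixP => k l; rewrite ord1 Tmx_tvec ?mxE; last lia.
case: ltnP => // nk; rewrite lcoef_eq0 //.
by apply: leq_trans (size_tpoly _) _; lia.
Qed.

(** The entries are Legendre coefficients of [tpoly n.+1], with the last one replaced by 0. Bessel
    bounds them by the integral of its square, from which the divisor 2(n + 1) + 1 is then
    discarded. *)
Lemma Tmx_tvec_norm n : \sum_(k < n.+2) (Tmx R n.+2 *m tvec n.+2 n) k 0 ^+ 2 <=
  2 * (2 ^+ n.+1 / n.+1`!%:R) ^+ 2.
Proof.
apply: (@le_trans _ _ (\sum_(k < n.+2) lcoef (tpoly n.+1) k ^+ 2)).
  apply: ler_sum => k _; rewrite Tmx_tvec //; case: ifP => // _.
  by rewrite expr0n sqr_ge0.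
apply: le_trans (bessel _ _) _.
rewrite -scalerAl -scalerAr !pintZ pint_onep_exp; set c := (_%:R)^-1.
have -> : 2 * (2 ^+ n.+1 / n.+1`!%:R) ^+ 2 = c * (c * 2 ^+ (2 * n.+1).+1) :> R.
  by rewrite [2 ^+ (_ * _).+1]exprS mulnC exprM -/c; ring.
have c0 : 0 <= c by rewrite invr_ge0.
by rewrite !ler_wpM2l // ler_piMr ?exprn_ge0 // invf_le1 ?ler1n ?ltr0n.
Qed.

End TaylorCoefficients.

(** * Kronecker vectors and the telescoping solution of the linear system *)

Section Kronecker.
Variables (R : realType) (N n : nat).
Local Notation M := n.+2.
Implicit Types (A C : 'M[R[i]]_N) (v : 'cV[R[i]]_N) (w : 'cV[R[i]]_M).

Definition tensv v w : 'cV[R[i]]_(N * M) :=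
  \col_k (v (mxtens_unindex k).1 0 * w (mxtens_unindex k).2 0).

Lemma sum_tens (F : 'I_(N * M) -> R) :
  \sum_k F k = \sum_(i < N) \sum_(k < M) F (mxtens_index (i, k)).
Proof.
rewrite pair_big (reindex (@mxtens_unindex N M)) /=; last first.
  by exists (@mxtens_index N M) => x _; rewrite (mxtens_indexK, mxtens_unindexK).
by apply: eq_bigr => k _; rewrite -{1}[k]mxtens_unindexK.
Qed.

Lemma mul_tens_tensv A (B : 'M[R[i]]_M) v w :
  (A *t B) *m tensv v w = tensv (A *m v) (B *m w).
Proof.
apply/matrixP => k l; case: (mxtens_indexP k) => {}k k'.
rewrite !mxE mxtens_indexK mulr_sum; apply: eq_bigr => j _.
by rewrite !mxE mxtens_indexK mulrACA.
Qed.

Lemma enorm_tensv v w :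
  enorm (tensv v w) = enorm v * enorm w.
Proof.
apply/eqP; rewrite -(@eqrXn2 _ 2) ?mulr_ge0 ?enorm_ge0 //.
rewrite exprMn !sqr_enorm sum_tens mulr_suml; apply/eqP/eq_bigr => i _.
rewrite mulr_sumr; apply: eq_bigr => k _.
by rewrite mxE mxtens_indexK Normc.normcM exprMn.
Qed.

(** The operator I (x) phi(t)^T, with the row index set N * 1 of its result already identified with
    N. *)
Definition contract_phi (t : R) (z : 'cV[R[i]]_(N * M)) : 'cV[R[i]]_N :=
  \col_i \sum_(k < M) ((legendre R k).[t])%:C * z (mxtens_index (i, k)) 0.

(** Cauchy-Schwarz in each of the N blocks, with |phi(t)|^2 <= M^2 / 2. *)
Lemma enorm_contract_phi t z : -1 <= t <= 1 ->
  enorm (contract_phi t z) <= M%:R / Num.sqrt 2 * enorm z.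
Proof.
move=> t1; apply: enorm_le; first by rewrite !mulr_ge0 ?invr_ge0 ?sqrtr_ge0 ?enorm_ge0.
rewrite !exprMn exprVn sqr_sqrtr // sqr_enorm sum_tens mulr_sumr.
apply: ler_sum => i _; rewrite mxE.
apply: (@le_trans _ _ ((\sum_(k < M) (legendre R k).[t] ^+ 2) *
    \sum_k Normc.normc (z (mxtens_index (i, k)) 0) ^+ 2)); last first.
  by rewrite ler_wpM2r ?sum_legendre_sqr_le // sumr_ge0 // => k _; exact: sqr_ge0.
under [X in X * _]eq_bigr => k _ do rewrite -[_ ^+ 2]ger0_norm ?sqr_ge0 // normrX.
apply: le_trans (cauchy_schwarz _ _); rewrite ler_pXn2r ?nnegrE ?normc_ge0 //; last first.
  by apply: sumr_ge0 => k _; rewrite mulr_ge0 ?normc_ge0.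
apply: le_trans (normc_sum _ _) _; apply: ler_sum => k _.
by rewrite Normc.normcM normc_real.
Qed.

Lemma castmx_muln1E (X : 'M[R[i]]_(N * 1)) i j :
  castmx (muln1 N, muln1 N) X i j = X (mxtens_index (i, 0)) (mxtens_index (j, 0)).
Proof.
by rewrite castmxE; congr (X _ _); apply: val_inj; rewrite /= muln1 addn0.
Qed.

Lemma mul_row_tens t (z : 'cV[R[i]]_(N * M)) i :
  (((1%:M : 'M[R[i]]_N) *t (cplxmx (phi M t))^T) *m z) (mxtens_index (i, 0)) 0 =
  contract_phi t z i 0.
Proof.
rewrite !mxE (reindex (@mxtens_index N M)) /=; last first.
  by exists (@mxtens_unindex N M) => x _; rewrite (mxtens_indexK, mxtens_unindexK).
rewrite (eq_bigr (fun p : 'I_N * 'I_M => (1%:M : 'M[R[i]]_N) i p.1 *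
    (((legendre R p.2).[t])%:C * z (mxtens_index (p.1, p.2)) 0))); last first.
  by case=> j k _; rewrite tensmxE !mxE mulrA.
rewrite -(pair_bigA _ (fun (j : 'I_N) (k : 'I_M) => (1%:M : 'M[R[i]]_N) i j *
    (((legendre R k).[t])%:C * z (mxtens_index (j, k)) 0))) /= (bigD1 i) //=.
rewrite [X in _ + X]big1 ?addr0 => [|j ji].
  by apply: eq_bigr => k _; rewrite mxE eqxx mul1r.
by apply: big1 => k _; rewrite mxE eq_sym (negbTE ji) mul0r.
Qed.

Lemma castmx_contract_phi t (D : 'M[R[i]]_(N * M)) C w v :
  castmx (muln1 N, muln1 N)
    (((1%:M : 'M[R[i]]_N) *t (cplxmx (phi M t))^T) *m D *m (C *t w)) *m v =
  contract_phi t (D *m tensv (C *m v) w).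
Proof.
apply/matrixP => i j; rewrite [j]ord1 -mul_row_tens mulmxA; move: (_ *m D) => E.
rewrite mxE [RHS]mxE; under eq_bigr do rewrite castmx_muln1E mxE mulr_suml.
rewrite exchange_big /=; apply: eq_bigr => b _.
case: (mxtens_indexP b) => b1 b2; rewrite [tensv _ _ _ _]mxE mxtens_indexK mxE.
rewrite mulr_suml mulr_sumr; apply: eq_bigr => k _.
by rewrite tensmxE; ring.
Qed.

Lemma contract_phiD t z1 z2 : contract_phi t (z1 + z2) = contract_phi t z1 + contract_phi t z2.
Proof.
apply/matrixP => i j; rewrite !mxE -big_split; apply: eq_bigr => k _.
by rewrite mxE mulrDr.
Qed.

Lemma contract_phi_sum t I (r : seq I) (F : I -> 'cV[R[i]]_(N * M)) :
  contract_phi t (\sum_(i <- r) F i) = \sum_(i <- r) contract_phi t (F i).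
Proof.
apply: (big_morph (contract_phi t) (@contract_phiD t)).
by apply/matrixP => i j; rewrite !mxE; apply: big1 => k _; rewrite mxE mulr0.
Qed.

Lemma contract_phi_tensv t v (x : 'cV[R]_M) :
  contract_phi t (tensv v (cplxmx x)) = (((phi M t)^T *m x) 0 0)%:C *: v.
Proof.
apply/matrixP => i j; rewrite [j]ord1 !mxE rmorph_sum mulr_suml.
apply: eq_bigr => k _; rewrite !mxE mxtens_indexK rmorphM /=; ring.
Qed.

(** The operator maps the k-th summand to itself minus A^(k+1) v (x) T_M v_k, which is the next
    summand as long as T_M v_k = v_(k+1). The sum telescopes, and only its two ends survive. *)
Lemma resolvent_taylor A v m : (m < n.+1)%N ->
  (1%:M - ATmx M A) *m \sum_(j < m.+1) tensv (A ^+ j *m v) (cplxmx (tvec R M j)) =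
  tensv v (cplxmx (tvec R M 0)) -
  tensv (A ^+ m.+1 *m v) (cplxmx (Tmx R M *m tvec R M m)).
Proof.
have step k : (1%:M - ATmx M A) *m tensv (A ^+ k *m v) (cplxmx (tvec R M k)) =
    tensv (A ^+ k *m v) (cplxmx (tvec R M k)) -
    tensv (A ^+ k.+1 *m v) (cplxmx (Tmx R M *m tvec R M k)).
  by rewrite mulmxBl mul1mx mul_tens_tensv -map_mxM mulmxA exprS.
elim: m => [|m IH] mn; rewrite big_ord_recr /= mulmxDr step.
  by rewrite big_ord0 mulmx0 add0r expr0 mul1mx.
rewrite IH ?(ltn_trans _ mn) // -Tmx_tvecS // addrA subrK //.
Qed.

(** The right-hand side e_1 sqrt 2 is the coefficient vector of [tpoly 0], so [resolvent_taylor] can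
    be solved for the exact solution. Contracting with phi(t) turns each coefficient vector back
    into the value of its polynomial. *)
Lemma legendre_approx_expansion A v t : 1%:M - ATmx M A \in unitmx ->
  legendre_approx M A t *m v =
  \sum_(j < n.+1) ((tpoly R j).[t])%:C *: (A ^+ j *m v) +
  contract_phi t (invmx (1%:M - ATmx M A) *m
    tensv (A ^+ n.+1 *m v) (cplxmx (Tmx R M *m tvec R M n))).
Proof.
move=> uD; rewrite castmx_contract_phi mul1mx -tvec0.
have /eqP := resolvent_taylor A v (ltnSn n); rewrite eq_sym subr_eq => /eqP ->.
rewrite mulmxDr mulKmx // contract_phiD contract_phi_sum; congr (_ + _).
apply: eq_bigr => j _.
by rewrite contract_phi_tensv phi_tvec ?mxE ?eqxx // ltnS ltnW // ltn_ord.
Qed.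

End Kronecker.

(** * The resolvent on the sequence space *)

Section Resolvent.
Variables (R : realType) (N n : nat).
Local Notation M := n.+2.
Implicit Types (A : 'M[R[i]]_N) (x : 'cV[R[i]]_(N * M)).

Definition tens_embed x : tensvec R N := fun i k =>
  if insub k is Some l then x (mxtens_index (i, l : 'I_M)) 0 else 0.

Definition tens_proj (X : tensvec R N) : 'cV[R[i]]_(N * M) :=
  \col_p X (mxtens_unindex p).1 (mxtens_unindex p).2.

Lemma tens_embedE x i (l : 'I_M) : tens_embed x i l = x (mxtens_index (i, l)) 0.
Proof.
rewrite /tens_embed insubT //= => lM.
by congr (x (mxtens_index (i, _)) 0); apply: val_inj.
Qed.

Lemma tens_embed_out x i k : (M <= k)%N -> tens_embed x i k = 0.
Proof. by move=> Mk; rewrite /tens_embed insubF // ltnNge Mk. Qed.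

Lemma tens_proj_embed x : tens_proj (tens_embed x) = x.
Proof.
apply/matrixP => p j; case: (mxtens_indexP p) => i l.
by rewrite [j]ord1 mxE mxtens_indexK tens_embedE.
Qed.

Lemma ell2norm_tens_embed x : ell2norm (tens_embed x) = (enorm x)%:E.
Proof.
rewrite /ell2norm (_ : limn _ = (\sum_(p < N * M) Normc.normc (x p 0) ^+ 2)%:E) //.
apply: lim_near_cst => //; exists M => // m /= Mm.
rewrite (big_cat_nat (leq0n M) Mm) //= [X in (_ + X)%E]big1_seq ?adde0; last first.
  move=> k /=; rewrite mem_index_iota => /andP[Mk _]; rewrite big1 // => i _.
  by rewrite tens_embed_out // Normc.normc0 expr0n.
rewrite big_mkord sumEFin sum_tens exchange_big; congr (_%:E).
by apply: eq_bigr => l _; apply: eq_bigr => i _; rewrite tens_embedE.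
Qed.

Lemma tensop_That A X i k : tensop A (That R M) X i k =
  \sum_j A i j * \sum_(l < M) (That R M k l)%:C * X j l.
Proof.
apply: eq_bigr => j _; congr (_ * _); apply: lim_near_cst; first exact: norm_hausdorff.
exists M => // m /= Mm.
rewrite /series /= (big_cat_nat (leq0n M) Mm) //=.
rewrite [X in _ + X]big1_seq ?addr0 ?big_mkord //.
move=> l /=; rewrite mem_index_iota => /andP[Ml _].
rewrite /That; case: insubP => [? _ _|_]; rewrite ?insubF ?mul0r //.
by apply/negbTE; rewrite -leqNgt.
Qed.

Lemma That_in (k l : 'I_M) : That R M k l = Tmx R M k l.
Proof.
by rewrite /That !insubT //= => lM kM; congr (Tmx R M _ _); apply: val_inj.
Qed.

Definition id_sub_tensop A X : tensvec R N :=
  fun i k => X i k - tensop A (That R M) X i k.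

Lemma id_sub_tensop_out A X i k : (M <= k)%N -> id_sub_tensop A X i k = X i k.
Proof.
move=> Mk; rewrite /id_sub_tensop tensop_That big1 ?subr0 // => j _.
rewrite big1 ?mulr0 // => l _; rewrite /That insubF ?mul0r //.
by apply/negbTE; rewrite -leqNgt.
Qed.

Lemma tens_proj_id_sub_tensop A X :
  tens_proj (id_sub_tensop A X) = (1%:M - ATmx M A) *m tens_proj X.
Proof.
rewrite mulmxBl mul1mx; apply/matrixP => p j; case: (mxtens_indexP p) => i l.
rewrite !mxE mxtens_indexK /=; congr (_ - _).
rewrite tensop_That; under [LHS]eq_bigr => j0 _ do rewrite mulr_sumr.
rewrite pair_big [RHS](reindex (@mxtens_index N M)) /=; last first.
  by exists (@mxtens_unindex N M) => y _; rewrite (mxtens_indexK, mxtens_unindexK).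
apply: eq_bigr => -[a b] _.
by rewrite tensmxE !mxE mxtens_indexK That_in !mxE mulrA.
Qed.

(** The operator is block diagonal: the finite matrix on indices below M, the identity on the
    others. *)
Lemma resolvent_inj A : 1%:M - ATmx M A \in unitmx -> injective (id_sub_tensop A).
Proof.
move=> uD X Y XY; have pXY : tens_proj X = tens_proj Y.
  by rewrite -[LHS](mulKmx uD) -tens_proj_id_sub_tensop XY tens_proj_id_sub_tensop mulKmx.
apply/funext => i; apply/funext => k; have [kM|Mk] := ltnP k M.
  have := congr1 (fun z : 'cV__ => z (mxtens_index (i, Ordinal kM)) 0) pXY.
  by rewrite !mxE mxtens_indexK.
by rewrite -(id_sub_tensop_out A X i Mk) XY id_sub_tensop_out.
Qed.

(** [resolvent] is a partial inverse, meaningful only on images of [ell2]: the embedded x is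
    exhibited as the image of the embedded finite solution, and injectivity then identifies its
    preimage. *)
Lemma resolvent_tens_embed A x : 1%:M - ATmx M A \in unitmx ->
  resolvent A (That R M) (tens_embed x) = tens_embed (invmx (1%:M - ATmx M A) *m x).
Proof.
move=> uD; set y := invmx _ *m x.
have -> : tens_embed x = id_sub_tensop A (tens_embed y).
  apply/funext => i; apply/funext => k; have [kM|Mk] := ltnP k M; last first.
    by rewrite id_sub_tensop_out // !tens_embed_out.
  have := congr1 (fun z : 'cV__ => z (mxtens_index (i, Ordinal kM)) 0)
    (tens_proj_id_sub_tensop A (tens_embed y)).
  rewrite tens_proj_embed mulKVmx // mxE mxtens_indexK /= => ->.
  by rewrite -[k]/(val (Ordinal kM)) tens_embedE.
have inj : {in @ell2 R N &, injective (id_sub_tensop A)}.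
  by move=> X Y _ _; exact: resolvent_inj.
rewrite /resolvent (pinvKV (fun=> fun=> fun=> 0) inj) //.
by rewrite inE /ell2 /= ell2norm_tens_embed ltry.
Qed.

(** Extension by zero is isometric and intertwines the two inverses, so embedded vectors compete in
    the supremum. *)
Lemma resolvent_norm_ub A x : 1%:M - ATmx M A \in unitmx -> enorm x <= 1 ->
  ((enorm (invmx (1%:M - ATmx M A) *m x))%:E <= resolvent_norm M A)%E.
Proof.
move=> uD x1; apply: ereal_sup_ubound.
exists (tens_embed x); first by rewrite /= ell2norm_tens_embed lee_fin.
by rewrite resolvent_tens_embed // ell2norm_tens_embed.
Qed.

Lemma enorm_resolvent A x r : 1%:M - ATmx M A \in unitmx ->
  resolvent_norm M A = r%:E ->
  enorm (invmx (1%:M - ATmx M A) *m x) <= r * enorm x.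
Proof.
move=> uD rE; have [/enorm_eq0 ->|x0] := eqVneq (enorm x) 0.
  by rewrite mulmx0 !enorm0 mulr0.
have xp : 0 < enorm x by rewrite lt_neqAle eq_sym x0 enorm_ge0.
have := @resolvent_norm_ub A ((enorm x)^-1%:C *: x) uD.
rewrite -scalemxAr !enormZ normc_real ger0_norm ?invr_ge0 ?enorm_ge0 //.
by rewrite mulVf // mulrC => /(_ (lexx _)); rewrite rE lee_fin ler_pdivrMr.
Qed.

Lemma enorm_delta m (j : 'I_m) : enorm (delta_mx j 0 : 'cV[R[i]]_m) = 1.
Proof.
rewrite /enorm (bigD1 j) //= big1 ?addr0 => [|k kj].
  by rewrite mxE !eqxx Normc.normc1 expr1n sqrtr1.
by rewrite mxE (negbTE kj) Normc.normc0 expr0n.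
Qed.

Lemma ATmx_last_row A i p : ATmx M A (mxtens_index (i, ord_max)) p = 0.
Proof.
by case: (mxtens_indexP p) => j k; rewrite tensmxE !mxE ltnn mulr0.
Qed.

(** Because the last row of T_M is zero, the row p of I - A (x) T_M is that of the identity, so the
    solution for the unit vector at p has entry 1 at p. *)
Lemma resolvent_norm_ge1 A : (0 < N)%N -> 1%:M - ATmx M A \in unitmx ->
  (1 <= resolvent_norm M A)%E.
Proof.
move=> N0 uD; pose p : 'I_(N * M) := mxtens_index (Ordinal N0, ord_max).
have := @resolvent_norm_ub A (delta_mx p 0) uD; rewrite enorm_delta => /(_ (lexx _)).
apply: le_trans; rewrite lee_fin; set y := invmx _ *m _.
suff <- : Normc.normc (y p 0) = 1 by exact: normc_le_enorm.
have : ((1%:M - ATmx M A) *m y) p 0 = 1 by rewrite mulKVmx // mxE !eqxx.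
rewrite mulmxBl mul1mx !mxE [X in _ - X]big1 => [|q _]; last first.
  by rewrite ATmx_last_row mul0r.
by rewrite subr0 => ->; rewrite Normc.normc1.
Qed.

End Resolvent.

(** * The exponential series *)

Section Exponential.
Variable R : realType.
Local Notation normc := Normc.normc.
Implicit Types (z : R[i]).

Lemma cvg_complexP (f : nat -> R[i]) (l : R[i]) :
  f @ \oo --> l <-> forall e : R, 0 < e -> \forall k \near \oo, normc (l - f k) < e.
Proof.
split=> [/cvgrPdist_lt H e e0|H].
  have e0' : 0 < e%:C by rewrite ltcR.
  by have := H _ e0'; apply: filterS => k; rewrite -ltcR.
apply/cvgrPdist_lt => -[a b]; rewrite ltcE /= => /andP[/eqP -> /H].
by apply: filterS => k; rewrite -ltcR.
Qed.

Lemma normc_le_ReIm z : normc z <= `|complex.Re z| + `|complex.Im z|.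
Proof.
case: z => a b /=; rewrite -[leRHS]ger0_norm ?addr_ge0 // -sqrtr_sqr ler_wsqrtr //.
by rewrite sqrrD !real_normK ?num_real // lerD2r lerDl mulrn_wge0 // mulr_ge0.
Qed.

Lemma ge_Re_normc z : `|complex.Re z| <= normc z.
Proof.
by case: z => a b /=; rewrite -sqrtr_sqr ler_wsqrtr // lerDl sqr_ge0.
Qed.

Lemma ge_Im_normc z : `|complex.Im z| <= normc z.
Proof.
by case: z => a b /=; rewrite -sqrtr_sqr ler_wsqrtr // lerDr sqr_ge0.
Qed.

Lemma normed_cvg_complex (u : nat -> R[i]) :
  cvgn (series (fun k => normc (u k))) -> exists l : R[i], series u @ \oo --> l.
Proof.
move=> cu.
have cRe : cvgn (series (fun k => complex.Re (u k))).
  apply: normed_cvg; apply: series_le_cvg cu => k //=; first exact: normc_ge0.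
  exact: ge_Re_normc.
have cIm : cvgn (series (fun k => complex.Im (u k))).
  apply: normed_cvg; apply: series_le_cvg cu => k //=; first exact: normc_ge0.
  exact: ge_Im_normc.
exists (Complex (limn (series (fun k => complex.Re (u k))))
  (limn (series (fun k => complex.Im (u k))))).
apply/cvg_complexP => e e0; have e2 : 0 < e / 2 by rewrite divr_gt0.
move/cvgrPdist_lt: cRe => /(_ _ e2) cRe; move/cvgrPdist_lt: cIm => /(_ _ e2) cIm.
near=> k; apply: le_lt_trans (normc_le_ReIm _) _.
have ReIm m : series u m =
    Complex (series (fun k => complex.Re (u k)) m) (series (fun k => complex.Im (u k)) m).
  elim: m => [|m IH]; first by rewrite /series /= !big_geq.
  by rewrite !seriesSr IH /=; case: (u m).
by rewrite ReIm /= [ltRHS]splitr ltrD //; near: k.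
Unshelve. all: by end_near. Qed.

Definition expterm z (k : nat) : R[i] := (k`!%:R)^-1 * z ^+ k.

Lemma normc_nat k : normc (k%:R : R[i]) = k%:R.
Proof. by rewrite -[k%:R](rmorph_nat (real_complex R)) normc_real normr_nat. Qed.

Lemma normc_expterm z k : normc (expterm z k) = exp_coeff (normc z) k.
Proof.
by rewrite /expterm Normc.normcM Normc.normcV normc_nat normcX mulrC.
Qed.

Lemma cvg_expterm z : exists l : R[i], series (expterm z) @ \oo --> l.
Proof.
apply: normed_cvg_complex; rewrite (_ : (fun _ => _) = exp_coeff (normc z)).
  exact: is_cvg_series_exp_coeff.
by apply/funext => k; exact: normc_expterm.
Qed.

(** From index n on, successive terms have ratio at most 1/2, so the geometric series dominates. *)
Lemma exp_coeff_tail (x : R) n m : 0 <= x -> x <= n%:R / 2 ->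
  \sum_(n <= k < (n + m)%N) exp_coeff x k <= exp_coeff x n * (2 - 2 / 2 ^+ m).
Proof.
move=> x0 xn.
have decr j : exp_coeff x (n + j)%N <= exp_coeff x n / 2 ^+ j.
  elim: j => [|j IH]; first by rewrite addn0 expr0 divr1.
  rewrite addnS (_ : exp_coeff x (n + j).+1%N =
      exp_coeff x (n + j)%N * (x / (n + j)%N.+1%:R)).
    rewrite exprSr invfM [leRHS]mulrA; apply: ler_pM => //; first exact: exp_coeff_ge0.
      by rewrite divr_ge0.
    rewrite ler_pdivrMr ?ltr0n // -[(n + j)%N.+1%:R]natr1 natrD.
    by have : 0 <= j%:R :> R by []; lra.
  rewrite /exp_coeff /= factS natrM invfM exprSr; ring.
elim: m => [|m IH]; first by rewrite addn0 big_geq // expr0; lra.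
rewrite addnS big_nat_recr ?leq_addr //=; apply: le_trans (lerD IH (decr m)) _.
have : exp_coeff x n / 2 ^+ m = 2 * (exp_coeff x n / 2 ^+ m.+1).
  by rewrite exprS; field.
by rewrite exprS; lra.
Qed.

Lemma exp_tail z e n : series (expterm z) @ \oo --> e -> normc z <= n%:R / 2 ->
  normc (e - series (expterm z) n) <= 2 * (normc z ^+ n / n`!%:R).
Proof.
move=> /cvg_complexP ze zn; apply/ler_addgt0Pr => d d0.
have [k _ H] := ze _ d0.
have := H (n + k)%N (leq_addl _ _) => Hk.
rewrite (_ : e - _ = (e - series (expterm z) (n + k)%N) +
    (series (expterm z) (n + k)%N - series (expterm z) n)); last by rewrite addrA subrK.
apply: le_trans (le_normcD _ _) _; rewrite [leRHS]addrC; apply: lerD (ltW Hk) _.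
rewrite /series /= (big_cat_nat (leq0n n) (leq_addr k n)) /=.
rewrite addrAC subrr add0r; apply: le_trans (normc_sum _ _) _.
under eq_bigr do rewrite normc_expterm.
apply: le_trans (exp_coeff_tail k (normc_ge0 z) zn) _.
rewrite mulrC ler_wpM2r ?exp_coeff_ge0 ?normc_ge0 // gerBl divr_ge0 // exprn_ge0 //.
Qed.

Lemma cvg_mx_coord m n (f : nat -> 'M[R[i]]_(m, n)) (l : 'M[R[i]]_(m, n)) :
  (forall i j, (f k i j) @[k --> \oo] --> l i j) -> f @ \oo --> l.
Proof.
move=> H; apply/cvg_ballP => e e0.
have : \forall k \near \oo, forall p : 'I_m * 'I_n, ball (l p.1 p.2) e (f k p.1 p.2).
  by apply: filter_forall => p; move: (H p.1 p.2) => /cvg_ballP/(_ _ e0).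
by apply: filterS => k Hk; split=> // i j; exact: (Hk (i, j)).
Qed.

Lemma diagonalizable_expr n (Z : 'M[R[i]]_n) (d : 'rV[R[i]]_n) k : Z \in unitmx ->
  (Z *m diag_mx d *m invmx Z) ^+ k =
  Z *m diag_mx (\row_a d 0 a ^+ k) *m invmx Z.
Proof.
move=> uZ; elim: k => [|k IH].
  rewrite expr0 (_ : diag_mx _ = 1%:M) ?mulmx1 ?mulmxV //.
  by apply/matrixP => a b; rewrite !mxE expr0.
have -> : (Z *m diag_mx d *m invmx Z) ^+ k.+1 =
    Z *m diag_mx d *m invmx Z *m (Z *m diag_mx d *m invmx Z) ^+ k by rewrite exprS.
rewrite IH !mulmxA mulmxKV // -[Z *m _ *m _]mulmxA mulmx_diag.
by congr (_ *m diag_mx _ *m _); apply/rowP => a; rewrite !mxE exprS.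
Qed.

(** Each matrix entry of a partial sum is a fixed finite combination of the scalar partial sums at
    the eigenvalues, so the limit can be taken entrywise. *)
Lemma expmx_diag n (Z : 'M[R[i]]_n) (d e : 'rV[R[i]]_n) (s : R[i]) : Z \in unitmx ->
  (forall i, series (expterm (s * d 0 i)) @ \oo --> e 0 i) ->
  expmx (s *: (Z *m diag_mx d *m invmx Z)) = Z *m diag_mx e *m invmx Z.
Proof.
move=> uZ de; apply: cvg_lim; first exact: norm_hausdorff.
apply: cvg_mx_coord => i j.
have -> : s *: (Z *m diag_mx d *m invmx Z) =
    Z *m diag_mx (\row_a (s * d 0 a)) *m invmx Z.
  rewrite scalemxAl scalemxAr; congr (_ *m _ *m _).
  by apply/matrixP => a b; rewrite !mxE mulrnAr.
rewrite (_ : (fun k => _) = (fun k => \sum_a (Z i a * invmx Z a j) *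
    series (expterm (s * d 0 a)) k)).
  rewrite (_ : _ i j = \sum_a (Z i a * invmx Z a j) * e 0 a).
    apply: cvg_big => [|a _]; first exact: add_continuous.
    by apply: cvgMl_tmp; exact: de.
  by rewrite mxE; apply: eq_bigr => a _; rewrite mul_mx_diag mxE mulrAC.
apply/funext => k; rewrite /series /= summxE.
under [RHS]eq_bigr do rewrite mulr_sumr.
rewrite exchange_big /=; apply: eq_bigr => l _.
rewrite diagonalizable_expr // mxE mxE mulr_sumr.
apply: eq_bigr => a _; rewrite mul_mx_diag !mxE /expterm; ring.
Qed.

End Exponential.

(** * The error bound *)

Section RealEstimates.
Variable R : realType.

(** With u = w / 8, it suffices that (1 + u)^8 >= 1 + 64 u^2, because 1 + u <= e^u. *)
Lemma expR_ge1Dsqr (w : R) : 0 <= w -> 1 + w ^+ 2 <= expR w.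
Proof.
move=> w0; rewrite (_ : w = 8%:R * (w / 8)); last by field.
rewrite expRM_natl; set u := w / 8; have u0 : 0 <= u by rewrite divr_ge0.
apply: (@le_trans _ _ ((1 + u) ^+ 8)); last first.
  by rewrite ler_pXn2r ?nnegrE ?expR_ge0 ?expR_ge1Dx // addr_ge0.
(* The quadratic deficit 28 - 64 = -36 is absorbed into a square, using the linear term and part of
   the cubic one; everything else is nonnegative. *)
have -> : (1 + u) ^+ 8 = 1 + 64 * u ^+ 2 + (8 * u * (1 - 9 / 4 * u) ^+ 2
  + 31 / 2 * u ^+ 3 + 70 * u ^+ 4 + 56 * u ^+ 5 + 28 * u ^+ 6 + 8 * u ^+ 7 + u ^+ 8).
  by field.
rewrite (_ : (8 * u) ^+ 2 = 64 * u ^+ 2); last by ring.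
by rewrite lerDl !addr_ge0 // ?exprn_ge0 // mulr_ge0 ?sqr_ge0 ?exprn_ge0 // ?divr_ge0 // mulr_ge0.
Qed.

Lemma expR1_le3 : expR 1 <= 3 :> R.
Proof.
(* Since e^(-1/6) >= 5/6, this bounds 1/e below, and (5/6)^6 > 1/3. *)
have h : (5 / 6) ^+ 6 <= (expR 1)^-1 :> R.
  rewrite -expRN (_ : -1 = 6%:R * (- 6^-1)); last by field.
  rewrite expRM_natl ler_pXn2r ?nnegrE ?expR_ge0 ?divr_ge0 //.
  by apply: le_trans (expR_ge1Dx _); lra.
have : 3^-1 <= (expR 1)^-1 :> R by apply: le_trans h; lra.
by rewrite lef_pV2 ?posrE ?expR_gt0.
Qed.

(** n^n / n! is a single term of the series of e^n. *)
Lemma expn_le_fact n : n%:R ^+ n <= expR 1 ^+ n * n`!%:R :> R.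
Proof.
case: n => [|n]; first by rewrite !expr0 fact0 mulr1.
rewrite -expRM_natl mulr1 -ler_pdivrMr ?ltr0n ?fact_gt0 //.
by apply: le_trans (expR_ge1Dxn n _); rewrite ?lerDr.
Qed.

(** From 2 rho <= (2/9) n r and n^n <= e^n n!, the quotient is at most (2e/9)^n r^n, and 2e/9 <
    1. *)
Lemma factorial_bound n (rho r : R) : 0 <= rho -> 9 * rho <= n%:R * r ->
  (2 * rho) ^+ n / n`!%:R <= r ^+ n.
Proof.
move=> rho0 rr; have nr0 : 0 <= n%:R * r by apply: le_trans rr; rewrite mulr_ge0.
rewrite ler_pdivrMr ?ltr0n ?fact_gt0 //.
have [->|n0] := posnP n; first by rewrite !expr0 fact0 mulr1.
have r0 : 0 <= r by rewrite -(pmulr_rge0 _ (_ : 0 < n%:R)) ?ltr0n.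
have [c cE] : {c : R | c = 2 / 9} by exists (2 / 9).
have c0 : 0 <= c by rewrite cE divr_ge0.
apply: (@le_trans _ _ ((c * (n%:R * r)) ^+ n)).
  by rewrite ler_pXn2r ?nnegrE ?mulr_ge0 //; rewrite cE; lra.
rewrite !exprMn mulrA [leLHS]mulrC ler_wpM2l ?exprn_ge0 // [leLHS]mulrC.
have cn0 : 0 <= c ^+ n by rewrite exprn_ge0.
apply: le_trans (ler_wpM2r cn0 (expn_le_fact n)) _.
rewrite mulrAC -exprMn ler_piMl // exprn_ile1 ?mulr_ge0 ?expR_ge0 //.
by rewrite cE; have := expR1_le3; lra.
Qed.

(* For a fixed centre, the ratio [x e^w / y] of the bound is at least           *)
(* [s = 9 rho / (M - 1)], because [e^w >= 1 + w^2] and [y <= 1 + x].             *)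
Lemma ratio_ge (x y s : R) : 0 < x -> y <= 1 + x -> 0 <= s ->
  x * expR (Num.sqrt (s / x)) < y -> s <= x * expR (Num.sqrt (s / x)) / y.
Proof.
move=> x0 yx s0; set w : R := Num.sqrt (s / x) => h.
have xw : x * w ^+ 2 = s by rewrite sqr_sqrtr ?divr_ge0 ?(ltW x0) // mulrC divfK ?gt_eqF.
have w0 : 0 <= w by rewrite sqrtr_ge0.
have xs : x + s <= x * expR w.
  by rewrite -xw -[X in X + _]mulr1 -mulrDr ler_pM2l // expR_ge1Dsqr.
have y0 : 0 < y by apply: le_lt_trans h; rewrite mulr_ge0 ?expR_ge0 // ltW.
(* From x + s <= x e^w < y <= 1 + x. It gives s y <= s (1 + x) <= x + s, as needed. *)
have s1 : s < 1 by rewrite -(ltrD2l x) [ltRHS]addrC (le_lt_trans xs) ?(lt_le_trans h).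
rewrite ler_pdivlMr //; apply: le_trans xs.
by apply: le_trans (ler_wpM2l s0 yx) _; nra.
Qed.

End RealEstimates.

(** * What convergence of the Taylor series says about the centre *)

Section Convergence.
Variables (R : realType) (N n : nat).
Local Notation M := n.+2.
Local Notation normc := Normc.normc.
Implicit Types A : 'M[R[i]]_N.

(* The last row of [T_M] vanishes, so [0] is an eigenvalue of [A (x) T_M] and     *)
(* the geometric series with ratio [- c / (1 - c)] has to converge.              *)
Lemma taylor_expandable_normc_lt A c : (0 < N)%N -> c != 1 ->
  taylor_expandable (ATmx M A) c -> normc c < normc (1 - c).
Proof.
move=> N0 c1 [_ cv]; pose p : 'I_(N * M) := mxtens_index (Ordinal N0, ord_max).
set X := ATmx M A in cv.
have Xp q : (X - c%:M) p q = - c * (p == q)%:R.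
  by rewrite [LHS]mxE /X ATmx_last_row !mxE add0r mulr_natr mulNrn.
have Xk k q : ((X - c%:M) ^+ k) p q = (- c) ^+ k * (p == q)%:R.
  elim: k q => [|k IH] q; first by rewrite !expr0 mul1r mxE.
  have -> : (X - c%:M) ^+ k.+1 = (X - c%:M) *m (X - c%:M) ^+ k by rewrite exprS.
  rewrite mxE (bigD1 p) //= big1 ?addr0 => [|r rp].
    by rewrite Xp IH eqxx mulr1 exprS mulrA.
  by rewrite Xp eq_sym (negbTE rp) mulr0 mul0r.
pose u k := (1 - c) ^- k.+1 * (- c) ^+ k.
have cvu : series u @ \oo --> (invmx (1%:M - X)) p p.
  rewrite (_ : series u = (fun B : 'M[R[i]]_(N * M) => B p p) \o
    series (fun k => ((1 - c) ^- k.+1) *: (X - c%:M) ^+ k)).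
    exact: cvg_comp cv (@coord_continuous _ _ _ p p _).
  apply/funext => m /=; rewrite /series /= summxE; apply: eq_bigr => k _.
  by rewrite mxE Xk eqxx mulr1.
have d0 : 0 < normc (1 - c).
  rewrite lt_neqAle normc_ge0 andbT eq_sym; apply: contra c1 => /eqP.
  by move/Normc.eq0_normc/subr0_eq => ->.
rewrite ltNge; apply/negP => cd.
(* Two consecutive partial sums this close to the limit force |u_m| < 1 / |1 - c|, whereas |c| >= |1
   - c| would give |u_m| >= 1 / |1 - c|. *)
have e0 : 0 < (normc (1 - c))^-1 / 2 by rewrite divr_gt0 ?invr_gt0.
move/cvg_complexP: cvu => /(_ _ e0)[m _ H].
have H1 := H m (leqnn m); have H2 := H m.+1 (leqnSn m).
suff : (normc (1 - c))^-1 <= normc (u m).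
  apply/negP; rewrite -ltNge [ltRHS]splitr.
  have -> : u m = (invmx (1%:M - X) p p - series u m) +
      - (invmx (1%:M - X) p p - series u m.+1).
    by rewrite seriesSr; ring.
  by apply: le_lt_trans (le_normcD _ _) _; rewrite normcN ltrD.
rewrite Normc.normcM Normc.normcV !normcX normcN exprS invfM -mulrA.
rewrite ler_peMr ?invr_ge0 ?normc_ge0 // mulrC ler_pdivlMr ?exprn_gt0 // mul1r.
by apply: lerXn2r; rewrite ?nnegrE ?normc_ge0.
Qed.

End Convergence.

(** * The two remainders and their comparison with the claimed bound *)

Section ErrorBound.
Variables (R : realType) (N n : nat).
Local Notation M := n.+2.
Local Notation normc := Normc.normc.
Variables (A Z : 'M[R[i]]_N) (Lambda : 'rV[R[i]]_N).
Hypotheses (N0 : (0 < N)%N) (uZ : Z \in unitmx).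
Hypothesis AE : A = Z *m diag_mx Lambda *m invmx Z.

Lemma normc_Lambda i : normc (Lambda 0 i) <= specradius A.
Proof. by rewrite AE; exact: specradius_diag. Qed.

Lemma specradius_ge0 : 0 <= specradius A.
Proof. exact: le_trans (normc_ge0 _) (normc_Lambda (Ordinal N0)). Qed.

Lemma cond_gt0 : 0 < cond Z.
Proof. exact: lt_le_trans ltr01 (cond_ge1 N0 uZ). Qed.

(** In the eigenbasis this is the scalar tail [exp_tail] at (t + 1) times an eigenvalue, of modulus
    at most 2 rho; the change of basis costs the factor [cond Z]. *)
Lemma exp_remainder t v : -1 <= t <= 1 -> 2 * specradius A <= n.+1%:R / 2 ->
  enorm v <= 1 ->
  enorm (expmx ((t + 1)%:C *: A) *m v
         - \sum_(j < n.+1) ((tpoly R j).[t])%:C *: (A ^+ j *m v)) <=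
  cond Z * (2 * ((2 * specradius A) ^+ n.+1 / n.+1`!%:R)).
Proof.
move=> /andP[t1 t2] rhon v1; set rho := specradius A in rhon *.
have zle i : normc ((t + 1)%:C * Lambda 0 i) <= 2 * rho.
  rewrite Normc.normcM normc_real ger0_norm; last lra.
  by apply: ler_pM; rewrite ?normc_ge0 ?normc_Lambda //; lra.
have /choice[e eP] i := cvg_expterm ((t + 1)%:C * Lambda 0 i).
have eP' i : series (expterm ((t + 1)%:C * Lambda 0 i)) @ \oo --> (\row_i e i) 0 i.
  by rewrite mxE; exact: eP.
rewrite AE (expmx_diag uZ eP').
have -> : \sum_(j < n.+1) ((tpoly R j).[t])%:C *: 
      ((Z *m diag_mx Lambda *m invmx Z) ^+ j *m v)
    = Z *m diag_mx (\row_i series (expterm ((t + 1)%:C * Lambda 0 i)) n.+1) *m invmx Z *m v.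
  rewrite [X in _ = _ *m X *m _ *m _](_ : _ = \sum_(j < n.+1)
      ((tpoly R j).[t])%:C *: diag_mx (\row_i Lambda 0 i ^+ j)).
    rewrite mulmx_sumr !mulmx_suml; apply: eq_bigr => j _.
    by rewrite diagonalizable_expr // -scalemxAr -!scalemxAl.
  apply/matrixP => a b; rewrite summxE !mxE /series /= big_mkord -sumrMnl.
  apply: eq_bigr => j _; rewrite !mxE horner_tpoly /expterm exprMn.
  rewrite !rmorphM fmorphV rmorphXn rmorph_nat /= -mulrnAr; ring.
rewrite -mulmxBl -mulmxBl -mulmxBr.
have -> : diag_mx (\row_i e i) -
    diag_mx (\row_i series (expterm ((t + 1)%:C * Lambda 0 i)) n.+1)
   = diag_mx (\row_i (e i - series (expterm ((t + 1)%:C * Lambda 0 i)) n.+1)).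
  by apply/matrixP => a b; rewrite !mxE -mulrnBl.
have rho0 : 0 <= rho := specradius_ge0.
have B0 : 0 <= 2 * ((2 * rho) ^+ n.+1 / n.+1`!%:R).
  by rewrite mulr_ge0 // divr_ge0 // exprn_ge0 // mulr_ge0.
apply: (le_trans (enorm_diagonalizable _ v B0 _)).
  move=> i; rewrite mxE; apply: le_trans (exp_tail (eP i) (le_trans (zle i) rhon)) _.
  rewrite ler_pM2l // ler_pM2r ?invr_gt0 ?ltr0n ?fact_gt0 //.
  by apply: lerXn2r; rewrite ?nnegrE ?normc_ge0 // mulr_ge0.
by rewrite ler_piMr // mulr_ge0 // ltW // cond_gt0.
Qed.

(** The factors are M / sqrt 2 from phi, g from the resolvent, [cond Z] times rho^(n+1) from the
    power of A, and sqrt 2 times 2^(n+1) / (n+1)! from the residual; the square roots cancel. *)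
Lemma contract_remainder t v g : -1 <= t <= 1 -> enorm v <= 1 ->
  1%:M - ATmx M A \in unitmx -> resolvent_norm M A = g%:E -> 0 <= g ->
  enorm (contract_phi t (invmx (1%:M - ATmx M A) *m
    tensv (A ^+ n.+1 *m v) (cplxmx (Tmx R M *m tvec R M n)))) <=
  cond Z * (M%:R * g * ((2 * specradius A) ^+ n.+1 / n.+1`!%:R)).
Proof.
move=> t1 v1 uD gE g0; set rho := specradius A.
have rho0 : 0 <= rho := specradius_ge0.
have s0 : 0 < Num.sqrt 2 :> R by rewrite sqrtr_gt0.
have Av : enorm (A ^+ n.+1 *m v) <= cond Z * rho ^+ n.+1.
  rewrite {1}AE diagonalizable_expr //.
  have B0 : 0 <= rho ^+ n.+1 by rewrite exprn_ge0.
  apply: (le_trans (enorm_diagonalizable _ v B0 _)).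
    move=> i; rewrite mxE normcX.
    by apply: lerXn2r; rewrite ?nnegrE ?normc_ge0 ?normc_Lambda.
  by rewrite ler_piMr // mulr_ge0 // ltW // cond_gt0.
have wle : enorm (cplxmx (Tmx R M *m tvec R M n)) <= Num.sqrt 2 * (2 ^+ n.+1 / n.+1`!%:R).
  have c0 : 0 <= 2 ^+ n.+1 / n.+1`!%:R :> R by rewrite divr_ge0 // exprn_ge0.
  apply: enorm_le; first by rewrite mulr_ge0 // ltW.
  rewrite [leRHS]exprMn sqr_sqrtr //; apply: le_trans (Tmx_tvec_norm R n).
  by apply: ler_sum => k _; rewrite [X in normc X]mxE normc_real real_normK ?num_real.
apply: le_trans (enorm_contract_phi _ t1) _.
apply: le_trans (ler_wpM2l _ (enorm_resolvent _ uD gE)) _.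
  by rewrite divr_ge0 // ltW.
rewrite enorm_tensv.
have := ler_pM (enorm_ge0 _) (enorm_ge0 _) Av wle.
rewrite -(ler_pM2l (_ : 0 < M%:R / Num.sqrt 2)); last by rewrite divr_gt0.
move=> /(ler_wpM2l g0); rewrite [leLHS]mulrCA => /le_trans; apply.
rewrite [(2 * rho) ^+ _]exprMn le_eqVlt; apply/orP; left; apply/eqP.
field; rewrite ?pnatr_eq0 -?lt0n ?fact_gt0 /= ?gt_eqF //.
Qed.

Lemma approx_error t g : -1 <= t <= 1 -> 2 * specradius A <= n.+1%:R / 2 ->
  1%:M - ATmx M A \in unitmx -> resolvent_norm M A = g%:E -> 0 <= g ->
  specnorm (expmx ((t + 1)%:C *: A) - legendre_approx M A t) <=
  cond Z * ((M%:R * g + 2) * ((2 * specradius A) ^+ n.+1 / n.+1`!%:R)).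
Proof.
move=> t1 rhon uD gE g0; apply: specnorm_le => v v1.
rewrite mulmxBl legendre_approx_expansion // opprD addrA.
apply: le_trans (enormD _ _) _; rewrite enormN.
rewrite [X in cond Z * X]mulrDl mulrDr [leRHS]addrC.
by apply: lerD; [exact: exp_remainder | exact: contract_remainder].
Qed.

(* The factor [28] leaves so much room that the first term of [K_M] is only      *)
(* needed when its denominator vanishes.                                          *)
Lemma error_bound c t : c != 0 -> c != 1 -> -1 <= t <= 1 ->
  taylor_expandable (ATmx M A) c -> normc c * mu M A c <= normc (1 - c) ->
  ((specnorm (expmx ((t + 1)%:C *: A) - legendre_approx M A t)%R)%:E
   <= (cond Z)%:E * Kconst M A c * M%:R%:E
      * (normc (c * (mu M A c)%:C / (1 - c)) ^+ M.-1)%:E)%E.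
Proof.
move=> c0 c1 t1 te cmu; have cd := taylor_expandable_normc_lt N0 c1 te.
have uD := te.1; have R1 := resolvent_norm_ge1 N0 uD.
have xp : 0 < normc c.
  rewrite lt_neqAle normc_ge0 andbT eq_sym; apply: contra c0.
  by move=> /eqP/Normc.eq0_normc ->.
have yp : 0 < normc (1 - c) := lt_trans xp cd.
have mup : 0 < mu M A c := expR_gt0 _.
have rE : normc (c * (mu M A c)%:C / (1 - c)) = normc c * mu M A c / normc (1 - c).
  by rewrite !Normc.normcM Normc.normcV normc_real gtr0_norm.
rewrite rE; set r := normc c * _ / _; have r0 : 0 < r by rewrite divr_gt0 // mulr_gt0.
(* An infinite [Kconst] makes the bound trivial, but only because all other factors are strictly
   positive: 0 times +oo would be 0. *)
have topcase : Kconst M A c = +oo%E ->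
  ((specnorm (expmx ((t + 1)%:C *: A) - legendre_approx M A t)%R)%:E
   <= (cond Z)%:E * Kconst M A c * M%:R%:E * (r ^+ M.-1)%:E)%E.
  move=> ->; rewrite gt0_muley ?lte_fin ?cond_gt0 // gt0_mulye ?lte_fin //.
  rewrite gt0_mulye ?leey //.
  by rewrite lte_fin exprn_gt0.
move: cmu; rewrite le_eqVlt => /predU1P[cmu|cmu].
  apply: topcase; rewrite /Kconst cmu subrr mul0r normr0 inve0 addye //.
  by rewrite gt_eqF // (lt_le_trans (ltNyr 0)) // mule_ge0 // (le_trans _ R1).
case gE : (resolvent_norm M A) R1 => [g| |] // R1; last first.
  apply: topcase; rewrite /Kconst gE gt0_muley // addey //.
  by rewrite gt_eqF // (lt_le_trans (ltNyr 0)) // inve_ge0 lee_fin.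
rewrite lee_fin in R1; have g0 : 0 <= g := le_trans ler01 R1.
have sr : 9 * specradius A / n.+1%:R <= r.
  have sx : 9 * specradius A / n.+1%:R / normc c = 9 * specradius A / (M.-1%:R * normc c).
    by rewrite invfM mulrA.
  have := @ratio_ge _ (normc c) (normc (1 - c)) (9 * specradius A / n.+1%:R) xp.
  rewrite sx; apply => //.
  - by apply: le_trans (le_normcD _ _) _; rewrite normcN Normc.normc1.
  - by rewrite divr_ge0 // mulr_ge0 // specradius_ge0.
have r1 : r < 1 by rewrite ltr_pdivrMr // mul1r.
have rn : 9 * specradius A <= n.+1%:R * r by rewrite [leRHS]mulrC -ler_pdivrMr ?ltr0n.
have n0 : 0 < n.+1%:R :> R by rewrite ltr0n.
(* The ratio condition of the exponential tail: 9 rho <= (n + 1) r with r < 1 gives 2 rho <= (2/9)(n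
   + 1). *)
have rhon : 2 * specradius A <= n.+1%:R / 2.
  have nr : n.+1%:R * r <= n.+1%:R by rewrite ler_piMr ?(ltW r1) ?(ltW n0).
  lra.
apply: (@le_trans _ _ ((cond Z)%:E * (28 * g)%:E * M%:R%:E * (r ^+ M.-1)%:E)%E); last first.
  apply: lee_wpmul2r; first by rewrite lee_fin exprn_ge0 // ltW.
  apply: lee_wpmul2r; first by rewrite lee_fin.
  apply: lee_wpmul2l; first by rewrite lee_fin ltW // cond_gt0.
  by rewrite /Kconst gE -EFinM leeDr // inve_ge0 lee_fin.
rewrite -!EFinM lee_fin; apply: le_trans (approx_error t1 rhon uD gE g0) _.
move: (cond Z) cond_gt0 => k k0; rewrite -!mulrA ler_pM2l //.
have f0 := factorial_bound specradius_ge0 rn.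
have C0 : 0 <= M%:R * g + 2 by rewrite addr_ge0 // mulr_ge0.
apply: le_trans (ler_wpM2l C0 f0) _.
rewrite !mulrA ler_pM2r ?exprn_gt0 //.
(* With g >= 1 and M >= 2, M g + 2 <= 2 M g, well below 28 M g. *)
have M2 : 2 <= M%:R :> R by rewrite ler_nat.
by nra.
Qed.

End ErrorBound.

Theorem theorem3p5 (R : realType) (N : nat) (hN : (0 < N)%N)
  (A Z : 'M[R[i]]_N) (Lambda : 'rV[R[i]]_N)
  (hZ : Z \in unitmx) (hA : A = Z *m diag_mx Lambda *m invmx Z)
  (M : nat) (hM : (2 <= M)%N) :
  (forall c : R[i],
     c != 0 -> c != 1 ->
     taylor_expandable (ATmx M A) c ->
     9 * specradius A * (Normc.normc c)^-1
       * (ln (Normc.normc (1 - c) / Normc.normc c)) ^- 2 + 1 <= M%:R ->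
     forall t : R, -1 <= t <= 1 ->
       ((specnorm (expmx ((t + 1)%:C *: A) - legendre_approx M A t)%R)%:E
        <= (cond Z)%:E * Kconst M A c * M%:R%:E
           * (Normc.normc (c * (mu M A c)%:C / (1 - c)) ^+ M.-1)%:E)%E)
  /\
  (let rho := specradius A in
   let c := (- (9 * rho / M.-1%:R))%:C in
   0 < rho ->
   taylor_expandable (ATmx M A) c ->
   18 * rho + 1 <= M%:R ->
   [/\ mu M A c = expR 1,
       Kconst M A c =
         ((`|(1 + 9 * rho / M.-1%:R - 9 * rho * expR 1 / M.-1%:R) * M%:R|%:E)^-1
          + 28%:E * resolvent_norm M A)%E
     & forall t : R, -1 <= t <= 1 ->
       ((specnorm (expmx ((t + 1)%:C *: A) - legendre_approx M A t)%R)%:E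
        <= (cond Z)%:E * Kconst M A c * M%:R%:E
           * (`|9 * rho * expR 1 / M.-1%:R| ^+ M.-1)%:E)%E]).
Proof.
case: M hM => [|[|n]] // _; split=> [c c0 c1 te hM t t1|rho c rho0 te hM].
  have cd := taylor_expandable_normc_lt hN c1 te.
  apply: (error_bound hN hZ hA c0 c1 t1 te).
  have xp : 0 < Normc.normc c.
    rewrite lt_neqAle normc_ge0 andbT eq_sym; apply: contra c0.
    by move=> /eqP/Normc.eq0_normc ->.
  have yp := lt_trans xp cd.
  set L := ln _ in hM; have L0 : 0 < L by rewrite ln_gt0 // ltr_pdivlMr // mul1r.
  have EL : expR L = Normc.normc (1 - c) / Normc.normc c.
    by rewrite lnK // posrE divr_gt0.
  (* The goal |c| mu <= |1 - c| becomes sqrt(9 rho / ((M - 1)|c|)) <= L; as L > 0, squaring it gives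
     the hypothesis on M. *)
  rewrite mulrC -ler_pdivlMr // -EL ler_expR.
  rewrite -(@ler_pXn2r _ 2) ?nnegrE ?sqrtr_ge0 ?(ltW L0) //.
  have rho0 := specradius_ge0 hN hZ hA.
  have p0 : 0 < n.+1%:R * Normc.normc c by rewrite mulr_gt0.
  rewrite sqr_sqrtr; last by rewrite divr_ge0 ?(ltW p0) // mulr_ge0.
  rewrite /= ler_pdivrMr //.
  move: hM; rewrite -[n.+2%:R]natr1 lerD2r ler_pdivrMr ?exprn_gt0 //.
  by rewrite ler_pdivrMr // => /le_trans; apply; rewrite [leRHS]mulrCA mulrA.
set q := 9 * rho / n.+1%:R in c te *.
have n0 : 0 < n.+1%:R :> R by rewrite ltr0n.
have q0 : 0 < q by rewrite divr_gt0 // mulr_gt0.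
(* This is M >= 18 rho + 1. Together with e <= 3 it yields q e <= 3 q <= 1 + q, the condition |c| mu
   <= |1 - c| for this centre. *)
have q2 : q <= 2^-1.
  by rewrite ler_pdivrMr //; move: hM; rewrite -[n.+2%:R]natr1; lra.
have nc : Normc.normc c = q by rewrite normc_real normrN gtr0_norm.
have c1E : 1 - c = (1 + q)%:C by rewrite /c rmorphN opprK rmorphD rmorph1.
have nc1 : Normc.normc (1 - c) = 1 + q by rewrite c1E normc_real gtr0_norm // addr_gt0.
have muE : mu n.+2 A c = expR 1.
  have nq : n.+1%:R * q = 9 * rho by rewrite mulrC divfK ?gt_eqF.
  by rewrite /mu nc nq divff ?sqrtr1 // gt_eqF // mulr_gt0.
have c0 : c != 0 by apply/eqP => h; move: q0; rewrite -nc h Normc.normc0 ltxx.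
have c1 : c != 1.
  apply/eqP => h; have := nc1; rewrite h subrr Normc.normc0; lra.
split=> //.
  by rewrite /Kconst muE nc nc1 [_ * expR 1 / _]mulrAC.
move=> t t1.
have e3 := expR1_le3 R.
apply: le_trans (error_bound hN hZ hA c0 c1 t1 te _) _.
  by rewrite muE nc nc1; nra.
(* The general ratio here is q e / (1 + q), at most the q e of the simplified bound; the prefactor
   is nonnegative. *)
apply: lee_wpmul2l.
  rewrite mule_ge0 ?lee_fin // mule_ge0 ?lee_fin ?(ltW (cond_gt0 hN hZ)) //.
  rewrite /Kconst adde_ge0 ?inve_ge0 ?lee_fin // mule_ge0 // ?lee_fin //.
  exact: le_trans (resolvent_norm_ge1 hN te.1).
rewrite lee_fin; apply: lerXn2r; rewrite ?nnegrE ?normc_ge0 ?normr_ge0 //.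
rewrite !Normc.normcM Normc.normcV nc nc1 normc_real muE ger0_norm ?expR_ge0 //.
rewrite [9 * _ * _ / _]mulrAC ger0_norm; last by rewrite mulr_ge0 ?expR_ge0 // ltW.
rewrite ler_pdivrMr ?addr_gt0 // ler_peMr ?lerDl ?(ltW q0) //.
by rewrite mulr_ge0 ?expR_ge0 ?(ltW q0).
Qed.
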